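(* Let $A$ be an $m\times m$ real symmetric positive definite matrix, let $\alpha=\mathrm{Tr}(A^{-2})/\{\mathrm{Tr}(A^{-1})\}^2$, so that $\frac1m\le\alpha<1$, and let $q$ be the integer with $q<1/\alpha\le q+1$. Let $L_L(A)$ be the Laguerre bound and $\lambda_m^*(A)$ the maximal smallest eigenvalue for the given values of $\mathrm{Tr}(A^{-1})$ and $\mathrm{Tr}(A^{-2})$, infinite eigenvalues being allowed. Then $$\frac{L_L(A)}{\lambda_m^*(A)}=\frac{m}{q(q+1)}\cdot\frac{q+\sqrt{q\{(q+1)\alpha-1\}}}{1+\sqrt{(m-1)(m\alpha-1)}},$$ which expresses the maximum possible gap as a function of $m$ and $\alpha$ ($q$ being determined uniquely by $\alpha$). For actual matrices, which have only finite eigenvalues, the right-hand side is, except in the case $q=m-1$ (for which no infinite eigenvalues are required for the maximum to be attained), a lower bound on the ratio of $L_L(A)$ to the smallest eigenvalue that can be approached arbitrarily closely. Moreover: (i) When $\frac1m\le\alpha<\frac1{m-1}$, one has $q=m-1$ and $$\frac{L_L(A)}{\lambda_m^*(A)}=\frac{1}{m-1}\left\{1+\frac{m-2}{1+\sqrt{(m-1)(m\alpha-1)}}\right\}.$$ This is a decreasing function of $\alpha$, takes the maximum value $1$ at $\alpha=\frac1m$, and approaches $\frac12\cdot\frac{m}{m-1}$ as $\alpha\to\frac1{m-1}$. Hence $L_L(A)/\lambda_m^*(A)>\frac12$ all over this region. (ii) When $\frac1m\ll\alpha\ll1$, one has $1\ll q\ll m$ and therefore $L_L(A)/\lambda_m^*(A)\simeq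 1/\sqrt q$. (iii) When $\frac12\le\alpha<1$, one has $q=1$ and $$\frac{L_L(A)}{\lambda_m^*(A)}=\frac m2\cdot\frac{1+\sqrt{2\alpha-1}}{1+\sqrt{(m-1)(m\alpha-1)}}.$$ For $\frac12\le\alpha<1$ this is an increasing function of $\alpha$ that takes the minimum value $$\frac{1}{\sqrt2}\cdot\frac{1}{\frac{\sqrt2}{m}+\sqrt{\left(1-\frac1m\right)\left(1-\frac2m\right)}}$$ at $\alpha=\frac12$ and approaches $1$ as $\alpha\to1$. Thus, when $m$ is large, $L_L(A)/\lambda_m^*(A)$ is almost larger than $\frac1{\sqrt2}$ all over this region. In summary, the Laguerre bound is fairly tight when $\alpha$ is close to $\frac1m$ or greater than $\frac12$, and can be loose when $\alpha$ is in the intermediate region.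
   Context: The Laguerre bound, a lower bound on the smallest eigenvalue $\lambda_m(A)$ of $A$, is $$L_L(A)=\frac{1}{\mathrm{Tr}(A^{-1})}\cdot\frac{m}{1+\sqrt{(m-1)\left[m\cdot\frac{\mathrm{Tr}(A^{-2})}{\{\mathrm{Tr}(A^{-1})\}^2}-1\right]}}.$$ With $a=\mathrm{Tr}(A^{-1})$ and $b=\mathrm{Tr}(A^{-2})$ held fixed, $\lambda_m^*(A)$ is the maximum of $\lambda_m$ over all eigenvalue tuples $\lambda_1\ge\cdots\ge\lambda_m>0$ with $\sum_{k=1}^m 1/\lambda_k=a$ and $\sum_{k=1}^m 1/\lambda_k^2=b$, where infinite eigenvalues are allowed (with $1/(+\infty)=0$). With $q$ the integer satisfying $q<a^2/b\le q+1$, it is given by $$\lambda_m^*(A)=\frac1a\cdot\frac{q(q+1)}{q+\sqrt{q\left[(q+1)\frac{b}{a^2}-1\right]}}.$$ The ratio $L_L(A)/\lambda_m^*(A)$ is used to measure the gap between the Laguerre bound and the smallest eigenvalue: it becomes one when there is no gap and zero when the gap is maximal. *)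

(* Defs.v *)
From HB Require Import structures.
From mathcomp Require Export all_boot all_order all_algebra.
From mathcomp Require Export all_classical all_reals all_analysis.
Export Order.TTheory GRing.Theory Num.Theory.
Export numFieldNormedType.Exports.

Set Implicit Arguments.
Unset Strict Implicit.
Unset Printing Implicit Defensive.

Local Open Scope classical_set_scope.
Local Open Scope ring_scope.

Definition symposdefmx (R : realType) (m : nat) (A : 'M[R]_m) : Prop :=
  A \is symmetricmx /\
  forall x : 'cV[R]_m, x != 0 -> 0 < (x^T *m A *m x) 0 0.

Definition invTrace (R : realType) (m : nat) (A : 'M[R]_m) : R :=
  \tr (invmx A).

Definition invSqTrace (R : realType) (m : nat) (A : 'M[R]_m) : R :=
  \tr (invmx A *m invmx A).

Definition traceRatio (R : realType) (m : nat) (A : 'M[R]_m) : R :=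
  invSqTrace A / invTrace A ^+ 2.

Definition laguerreBound (R : realType) (m : nat) (A : 'M[R]_m) : R :=
  (invTrace A)^-1 *
  (m%:R / (1 + Num.sqrt ((m%:R - 1) *
                         (m%:R * (invSqTrace A / invTrace A ^+ 2) - 1)))).

(* A symmetric matrix of positive size has finitely many, and at least one,
   real eigenvalues, so the infimum is a minimum. *)
Definition smallestEig (R : realType) (m : nat) (A : 'M[R]_m) : R :=
  inf [set l | eigenvalue A l].

(* The values of the last entry of the extended tuples
   lam_1 >= ... >= lam_m > 0 with sum 1/lam_k = a and sum 1/lam_k^2 = b.
   Entries may be +oo; the extended inverse satisfies (+oo)^-1 = 0. *)
Definition smallestEntries (R : realType) (m : nat) (a b : R) : set (\bar R) :=
  [set l | exists lam : 'I_m -> \bar R,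
    [/\ forall i j : 'I_m, (i <= j)%N -> (lam j <= lam i)%E,
        forall i, (0 < lam i)%E,
        (\sum_(i < m) (lam i)^-1)%E = a%:E,
        (\sum_(i < m) (lam i ^+ 2)^-1)%E = b%:E
      & exists k : 'I_m, k.+1 = m /\ l = lam k]].

Definition maxSmallestEig (R : realType) (m : nat) (A : 'M[R]_m) : R :=
  fine (ereal_sup (smallestEntries m (invTrace A) (invSqTrace A))).

Definition bracket (R : realType) (alpha : R) (q : int) : Prop :=
  q%:~R < alpha^-1 <= q%:~R + 1.

Definition qOf (R : realType) (alpha : R) : int :=
  xget 0 [set q : int | bracket alpha q].

Definition gapRatio (R : realType) (m : nat) (alpha : R) : R :=
  let q : R := (qOf alpha)%:~R in
  m%:R / (q * (q + 1)) *
  ((q + Num.sqrt (q * ((q + 1) * alpha - 1))) /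
   (1 + Num.sqrt ((m%:R - 1) * (m%:R * alpha - 1)))).

(* Main.v *)
Require Import Defs.
From mathcomp Require Import ring lra zify complex.

(** Everything is expressed through the inverse eigenvalues
    [mu_i = 1 / lambda_i], which are nonnegative, vanish exactly for infinite
    eigenvalues, have sum [a] and sum of squares [b].  Maximizing the smallest
    eigenvalue means minimizing the largest [mu_i].

    If all [mu_i] lie in [[0, N]] and have sum [S], then concavity of
    [x * (N - x)] forces the sum of the [mu_i * (N - mu_i)] to be at least
    [(S - q * N) * ((q + 1) * N - S)], for every natural number [q]
    ([sum_sqr_defect]); the inequality is strict when the [mu_i] are positive
    and more than [q + 1] in number ([sum_sqr_defect_lt]).  This is a quadratic
    inequality in [N].  When [q < a^2 / b <= q + 1], it forces [N] to be at
    least the larger root [peak q a b] ([peak_min], [peak_lt]).  The bound is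
    attained by [q] entries equal to the peak, one remainder, and zeros
    ([smallestEntries_max]); there are no zeros exactly when [q = m - 1]
    ([peak_attained]), and otherwise replacing the zeros by a small [e] gives
    positive tuples with the same [a] and [b] whose maximum tends to the peak
    ([peak_approached]).

    These facts about tuples become facts about matrices through the spectral
    theorem ([symposdef_spectrum]) in one direction and diagonal matrices
    ([diag_ratio]) in the other.  Since [lambda_m^*] is the inverse of the peak,
    the ratio formula is then an identity ([laguerre_peak]).

    What remains concerns the function [gapRatio].  For [q = m - 1] and
    [q = 1] it has the closed forms [gapLow] and [gapHigh], which are continuous
    and monotone; the latter is the less obvious one ([gapHigh_incr]).  In the
    intermediate regime the ratio times [sqrt q] is rewritten as an expression
    in [q * alpha], [q / m] and [1 / m], whose limits are 1, 0 and 0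
    ([gap_intermediate_cvg]).  One explicit sequence of diagonal matrices in
    this regime shows that the bound can be arbitrarily loose
    ([laguerre_ratio_loose]). *)

Set Implicit Arguments.
Unset Strict Implicit.
Unset Printing Implicit Defensive.

Local Open Scope classical_set_scope.
Local Open Scope ring_scope.

(** * An extremal inequality for sums of squares *)

(** The right-hand side is the sum of the [mu i * (N - mu i)].  The left-hand
    side, maximized over [q], is the [N]-periodic extension of [x * (N - x)] at
    the sum; the statement is the subadditivity of that function. *)
Lemma sum_sqr_defect (R : realFieldType) (m : nat) (mu : 'I_m -> R) (N : R)
    (q : nat) :
  (forall i, 0 <= mu i <= N) -> 0 <= N ->
  (\sum_i mu i - q%:R * N) * ((q%:R + 1) * N - \sum_i mu i)
    <= N * \sum_i mu i - \sum_i mu i ^+ 2.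
Proof.
move=> + N0; elim: m mu q => [|m IH] mu q Hmu.
  rewrite !big_ord0 mulr0 !sub0r subr0 oppr0 mulNr oppr_le0.
  by rewrite mulr_ge0 ?mulr_ge0 ?addr_ge0.
rewrite !big_ord_recl.
set S := \sum_(i < m) _; set S2 := \sum_(i < m) _ ^+ 2; set x := mu ord0.
have {}IH p := IH (fun i => mu (lift ord0 i)) p (fun i => Hmu _).
rewrite -/S -/S2 in IH.
have S0 : 0 <= S by apply: sumr_ge0 => i _; case/andP: (Hmu (lift ord0 i)).
have /andP[x0 xN] : 0 <= x <= N by exact: Hmu.
(* Adding [x] to a partial sum [S] changes the right side minus the left side
   by [2 * x * (S - q * N)], which has the right sign if [q * N <= S]; otherwise
   compare with [q - 1] for the partial sum, where the change is
   [2 * (N - x) * (q * N - S)]. *)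
have [Sq|Sq] := leP (q%:R * N) S.
  have : 0 <= x * (S - q%:R * N) by rewrite mulr_ge0// subr_ge0.
  have := IH q; nra.
case: q Sq => [|q] Sq; first by move: Sq; rewrite mul0r ltNge S0.
move: Sq (IH q); rewrite -natr1 => Sq IHq.
have : 0 <= (N - x) * ((q%:R + 1) * N - S).
  by rewrite mulr_ge0 ?subr_ge0// ltW.
nra.
Qed.

(** Each induction step gains strictly unless the partial sum is at most
    [q * N]; in that case [q] drops along with the number of entries, and at
    [q = 0] a nonempty positive partial sum gains strictly. *)
Lemma sum_sqr_defect_lt (R : realFieldType) (m : nat) (mu : 'I_m -> R) (N : R)
    (q : nat) :
  (forall i, 0 < mu i <= N) -> 0 <= N -> (q.+1 < m)%N ->
  (\sum_i mu i - q%:R * N) * ((q%:R + 1) * N - \sum_i mu i)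
    < N * \sum_i mu i - \sum_i mu i ^+ 2.
Proof.
move=> + N0; elim: m mu q => [//|m IH] mu q Hmu qm.
have Hmu' i : 0 <= mu (lift ord0 i) <= N.
  by case/andP: (Hmu (lift ord0 i)) => /ltW -> ->.
have weak := sum_sqr_defect q Hmu' N0.
have {}IH p := IH (fun i => mu (lift ord0 i)) p (fun i => Hmu _).
have Spos : 0 < \sum_(i < m) mu (lift ord0 i).
  case: m qm {weak IH} mu Hmu Hmu' => // m _ mu Hmu Hmu'.
  rewrite big_ord_recl ltr_pwDl ?sumr_ge0//; first by case/andP: (Hmu (lift ord0 ord0)).
  by move=> i _; case/andP: (Hmu' (lift ord0 i)).
rewrite !big_ord_recl.
move: weak IH Spos.
set S := \sum_(i < m) _; set S2 := \sum_(i < m) _ ^+ 2; set x := mu ord0.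
move=> weak IH S0.
have /andP[x0 xN] : 0 < x <= N by exact: Hmu.
(* For [S = q * N] the gain is zero both for [q] and for [q - 1]; the strictness
   of the induction hypothesis at [q - 1] covers this case. *)
have [Sq|Sq] := ltP (q%:R * N) S.
  have : 0 < x * (S - q%:R * N) by rewrite mulr_gt0// subr_gt0.
  nra.
case: q Sq qm weak => [|q] Sq qm _; first by move: Sq; rewrite mul0r leNgt S0.
move: Sq (IH q qm); rewrite -natr1 => Sq IHq.
have : 0 <= (N - x) * ((q%:R + 1) * N - S) by rewrite mulr_ge0 ?subr_ge0.
nra.
Qed.

(** The larger root [N] of [q * N^2 + (a - q * N)^2 = b]: the common value of
    the [q] maximal entries of the extremal tuple, whose remainder is
    [a - q * N]. *)
Definition peak (R : rcfType) (q : nat) (a b : R) : R :=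
  (a * q%:R + Num.sqrt (q%:R * ((q%:R + 1) * b - a ^+ 2))) / (q%:R * (q%:R + 1)).

Section Peak.
Context (R : rcfType) (q : nat) (a b : R).
Hypotheses (q0 : (0 < q)%N) (a0 : 0 < a) (qa : q%:R * b < a ^+ 2)
  (aq : a ^+ 2 <= (q%:R + 1) * b).

Local Notation Q := (q%:R : R).
Local Notation M := (peak q a b).
Local Notation D := (Num.sqrt (Q * ((Q + 1) * b - a ^+ 2))).

Let Q0 : 0 < Q. Proof. by rewrite ltr0n. Qed.
Let D0 : 0 <= D. Proof. exact: sqrtr_ge0. Qed.
Let D2 : D ^+ 2 = Q * ((Q + 1) * b - a ^+ 2).
Proof. by rewrite sqr_sqrtr// mulr_ge0 ?subr_ge0// ltW. Qed.
Let ME : Q * (Q + 1) * M = a * Q + D.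
Proof. by rewrite mulrC divfK// mulf_neq0 ?gt_eqF// addr_gt0. Qed.

Lemma peak_gt0 : 0 < M.
Proof.
rewrite divr_gt0//; first by rewrite ltr_wpDr// mulr_gt0.
by rewrite mulr_gt0// addr_gt0.
Qed.

(** The remainder is a positive multiple of [a - sqrt (q * ((q + 1) * b - a^2))],
    and [q * b < a^2] bounds the radicand by [a^2]. *)
Lemma peak_rest_gt0 : 0 < a - Q * M.
Proof.
have QM : (Q + 1) * M = a + D / Q.
  by apply: (mulfI (lt0r_neq0 Q0)); rewrite mulrA ME; field; rewrite gt_eqF.
have : D < a.
  rewrite -(@ltr_pXn2r _ 2)// ?nnegrE ?(ltW a0)// D2.
  have : 0 < (Q + 1) * (a ^+ 2 - Q * b) by rewrite mulr_gt0 ?subr_gt0 ?addr_gt0.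
  lra.
move=> Da; rewrite -(pmulr_rgt0 _ (addr_gt0 Q0 ltr01)).
have : (Q + 1) * (a - Q * M) = a - D by rewrite mulrBr mulrCA QM; field; rewrite gt_eqF.
by move->; rewrite subr_gt0.
Qed.

Lemma peak_rest_le : a - Q * M <= M.
Proof.
have : Q * a <= Q * ((Q + 1) * M) by rewrite mulrA ME mulrC lerDl.
rewrite ler_pM2l//; lra.
Qed.

Lemma peak_sum : Q * M ^+ 2 + (a - Q * M) ^+ 2 = b.
Proof.
have Qn : Q * (Q + 1) != 0 by rewrite mulf_neq0 ?gt_eqF// addr_gt0.
apply: (mulfI Qn).
have -> : Q * (Q + 1) * (Q * M ^+ 2 + (a - Q * M) ^+ 2) =
  (Q * (Q + 1) * M - a * Q) ^+ 2 + Q * a ^+ 2 by ring.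
by rewrite ME [a * Q + D]addrC addrK D2; ring.
Qed.

(** [sum_sqr_defect] says that [N] does not lie strictly between the two roots
    of the quadratic, and [b <= N * a] puts it to the right of their
    midpoint [a / (q + 1)]. *)
Lemma peak_min (m : nat) (mu : 'I_m -> R) (N : R) :
  (forall i, 0 <= mu i <= N) -> 0 <= N -> \sum_i mu i = a ->
  \sum_i mu i ^+ 2 = b -> M <= N.
Proof.
move=> Hmu N0 Sa Sb.
have := sum_sqr_defect q Hmu N0; rewrite Sa Sb => key.
have bN : b <= N * a.
  rewrite -Sa -Sb mulr_sumr ler_sum// => i _; case/andP: (Hmu i) => ? ?.
  by rewrite expr2 ler_wpM2r.
have QQ : 0 < Q * (Q + 1) by rewrite mulr_gt0// addr_gt0.
rewrite -(ler_pM2l QQ) ME -lerBrDl.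
have y0 : 0 <= Q * (Q + 1) * N - a * Q.
  have -> : Q * (Q + 1) * N - a * Q = Q * ((Q + 1) * N - a) by ring.
  apply: mulr_ge0; first exact: ltW.
  rewrite subr_ge0 -(ler_pM2l a0).
  rewrite -expr2 (le_trans aq)//.
  have -> : a * ((Q + 1) * N) = (Q + 1) * (N * a) by ring.
  by rewrite ler_wpM2l// addr_ge0// ltW.
rewrite -(@ler_pXn2r _ 2)// D2; nra.
Qed.

Lemma peak_lt (m : nat) (mu : 'I_m -> R) (N : R) :
  (forall i, 0 < mu i <= N) -> 0 <= N -> (q.+1 < m)%N -> \sum_i mu i = a ->
  \sum_i mu i ^+ 2 = b -> M < N.
Proof.
move=> Hmu N0 qm Sa Sb.
have weak : M <= N.
  by apply: (@peak_min _ mu) => // i; case/andP: (Hmu i) => /ltW -> ->.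
have := sum_sqr_defect_lt Hmu N0 qm; rewrite Sa Sb => key; rewrite lt_neqAle weak andbT.
apply/eqP => NM; have := peak_sum; rewrite NM => sumN.
lra.
Qed.

End Peak.

(** * Spectra of symmetric positive definite matrices *)

Lemma mulmx1_invmx (K : comUnitRingType) n (A B : 'M[K]_n) :
  A *m B = 1%:M -> invmx A = B.
Proof.
move=> AB; have [Au _] := mulmx1_unit AB.
by rewrite -[LHS]mulmx1 -AB mulmxA mulVmx// mul1mx.
Qed.

Lemma conjmx_mul (K : comUnitRingType) n (P A B : 'M[K]_n) : P \in unitmx ->
  (invmx P *m A *m P) *m (invmx P *m B *m P) = invmx P *m (A *m B) *m P.
Proof. by move=> Pu; rewrite !mulmxA mulmxK. Qed.

Lemma conjmx_sub_scalar (K : comUnitRingType) n (P A : 'M[K]_n) (c : K) :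
  P \in unitmx ->
  invmx P *m A *m P - c%:M = invmx P *m (A - c%:M) *m P.
Proof.
move=> Pu; rewrite mulmxBr mulmxBl; congr (_ - _).
by rewrite scalar_mxC -mulmxA mulVmx// mulmx1.
Qed.

Section Spectrum.
Context (R : realType) (m : nat).
Implicit Types (A : 'M[R]_m) (l : R).

Lemma eigenvalue_det0 A l : eigenvalue A l = (\det (A - l%:M) == 0).
Proof.
by rewrite /eigenvalue /eigenspace kermx_eq0 row_free_unit unitmxE unitfE negbK.
Qed.

Lemma symposdef_eigenvalue_gt0 A l : symposdefmx A -> eigenvalue A l -> 0 < l.
Proof.
move=> [_ posA] /eigenvalueP[v vA v0].
have := posA v^T; rewrite trmx_eq0 trmxK vA => /(_ v0).
rewrite -scalemxAl mxE.
have : 0 <= (v *m v^T) 0 0.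
  by rewrite mxE sumr_ge0// => i _; rewrite mxE -expr2 sqr_ge0.
move=> vv; rewrite le_eqVlt in vv; case/orP: vv => [/eqP <-|vv].
  by rewrite mulr0 ltxx.
by rewrite pmulr_lgt0.
Qed.

(** The spectral theorem for hermitian matrices over [C] diagonalizes
    the image of [A]; its spectrum is real, hence comes from [R], and the traces
    and the characteristic determinant are read off the diagonal form. *)
Lemma symposdef_spectrum_over (C : numClosedFieldType) (f : {rmorphism R -> C})
    A :
  (forall x, f x \is Num.real) ->
  (forall z, z \is Num.real -> exists x, z = f x) ->
  symposdefmx A -> exists d : 'I_m -> R,
  [/\ forall i, 0 < d i, forall l, eigenvalue A l <-> exists i, l = d i,
      invTrace A = \sum_i (d i)^-1 & invSqTrace A = \sum_i (d i)^-1 ^+ 2].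
Proof.
move=> freal fonto Apd; have [Asym _] := Apd.
pose B := map_mx f A.
have Bherm : B \is hermsymmx.
  apply: realsym_hermsym.
    rewrite qualifE /= expr0 scale1r; move: Asym; rewrite qualifE /= expr0 scale1r.
    by move=> /eqP AE; rewrite {1}/B {1}AE; apply/eqP/matrixP => i j; rewrite !mxE.
  by apply/mxOverP => i j; rewrite mxE freal.
have Bnorm : B \is normalmx by exact: hermitian_normalmx.
have /orthomx_spectralP := Bnorm; set P := spectralmx B; set D := spectral_diag B => BE.
have Pu : P \in unitmx by exact: spectral_unit.
have DR i : D 0 i \is Num.real by move/mxOverP: (hermitian_spectral_diag_real Bherm).
have /choice[d dE] : forall i, exists x, D 0 i = f x by move=> i; exact: fonto.
have eigE l : eigenvalue A l <-> exists i, l = d i.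
  rewrite eigenvalue_det0 -(fmorph_eq0 f) -det_map_mx map_mxB map_scalar_mx -/B.
  have -> : B - (f l)%:M = invmx P *m diag_mx (\row_i f (d i - l)) *m P.
    have -> : diag_mx (\row_i f (d i - l)) = diag_mx D - (f l)%:M.
      apply/matrixP => i j; rewrite !mxE dE rmorphB /= mulrnBl.
      by case: eqP => //= _; rewrite !mulr0n subr0.
    by rewrite -conjmx_sub_scalar// -BE.
  rewrite !det_mulmx mulrAC -det_mulmx mulVmx// det1 mul1r det_diag.
  split=> [/prodf_eq0[i _]|[i ->]].
    by rewrite mxE fmorph_eq0 subr_eq0 => /eqP <-; exists i.
  by rewrite (bigD1 i)//= mxE subrr rmorph0 mul0r.
have d0 i : 0 < d i.
  by apply: (symposdef_eigenvalue_gt0 Apd); apply/eigE; exists i.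
pose E := diag_mx (\row_i f (d i)^-1).
have invB : invmx B = invmx P *m E *m P.
  have DE : diag_mx D *m E = 1%:M.
    rewrite mulmx_diag; apply/matrixP => i j; rewrite !mxE dE -rmorphM /=.
    by rewrite mulfV ?lt0r_neq0// rmorph1.
  by apply: mulmx1_invmx; rewrite BE conjmx_mul// DE mulmx1 mulVmx.
have trP X : \tr (invmx P *m X *m P) = \tr X.
  by rewrite mxtrace_mulC mulmxA mulmxV// mul1mx.
exists d; split => //.
- apply: (fmorph_inj f); rewrite /invTrace -trace_map_mx map_invmx -/B invB trP.
  by rewrite mxtrace_diag rmorph_sum; apply: eq_bigr => i _; rewrite mxE.
- apply: (fmorph_inj f); rewrite /invSqTrace -trace_map_mx map_mxM map_invmx -/B.
  have -> : invmx B *m invmx B = invmx P *m (E *m E) *m P.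
    by rewrite invB conjmx_mul.
  rewrite trP mulmx_diag mxtrace_diag rmorph_sum; apply: eq_bigr => i _.
  by rewrite !mxE -rmorphM expr2.
Qed.

Lemma symposdef_spectrum A : symposdefmx A -> exists d : 'I_m -> R,
  [/\ forall i, 0 < d i, forall l, eigenvalue A l <-> exists i, l = d i,
      invTrace A = \sum_i (d i)^-1 & invSqTrace A = \sum_i (d i)^-1 ^+ 2].
Proof.
apply: (@symposdef_spectrum_over R[i] (real_complex R)) => [x|z].
  by apply/complex_realP; exists x.
by move=> /complex_realP.
Qed.

Lemma smallestEigE A (d : 'I_m -> R) i0 :
  (forall l, eigenvalue A l <-> exists i, l = d i) ->
  (forall i, d i0 <= d i) -> smallestEig A = d i0.
Proof.
move=> eigE dmin.
have lb : lbound [set l | eigenvalue A l] (d i0).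
  by move=> l /eigE[i ->].
apply/le_anti/andP; split.
  by apply: ge_inf; [exists (d i0)|apply/eigE; exists i0].
by apply: lb_le_inf => //; exists (d i0); apply/eigE; exists i0.
Qed.

Section Diagonal.
Context (mu : 'I_m -> R) (mu0 : forall i, 0 < mu i).
Local Notation B := (diag_mx (\row_i (mu i)^-1)).

Lemma diag_symposdef : symposdefmx B.
Proof.
split.
  by rewrite qualifE /= expr0 scale1r tr_diag_mx map_mx_id.
move=> x x0; rewrite mul_mx_diag mxE.
have [k xk] : exists k, x k 0 != 0.
  apply/existsP; apply: contraNT x0; rewrite negb_exists => /forallP x0.
  by apply/eqP/matrixP => i j; rewrite ord1 mxE; apply/eqP; have := x0 i; rewrite negbK.
have term i : (\matrix_(i, j) (x^T i j * (\row_i (mu i)^-1) 0 j)) 0 i * x i 0 =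
    x i 0 ^+ 2 / mu i.
  by rewrite !mxE mulrAC expr2.
rewrite (eq_bigr _ (fun i _ => term i)) (bigD1 k)//= ltr_wpDr//.
  by rewrite sumr_ge0// => i _; rewrite divr_ge0 ?sqr_ge0// ltW.
by rewrite divr_gt0// lt0r sqrf_eq0 xk sqr_ge0.
Qed.

Let invBE : invmx B = diag_mx (\row_i mu i).
Proof.
apply: mulmx1_invmx; rewrite mulmx_diag; apply/matrixP => i j; rewrite !mxE.
by rewrite mulVf ?lt0r_neq0.
Qed.

Lemma diag_invTrace : invTrace B = \sum_i mu i.
Proof.
by rewrite /invTrace invBE mxtrace_diag; apply: eq_bigr => i _; rewrite mxE.
Qed.

Lemma diag_invSqTrace : invSqTrace B = \sum_i mu i ^+ 2.
Proof.
rewrite /invSqTrace invBE mulmx_diag mxtrace_diag; apply: eq_bigr => i _.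
by rewrite !mxE expr2.
Qed.

Lemma diag_smallestEig i0 : (forall i, mu i <= mu i0) ->
  smallestEig B = (mu i0)^-1.
Proof.
move=> mumax; apply: (@smallestEigE _ (fun i => (mu i)^-1)) => [l|i].
  rewrite eigenvalue_det0.
  have -> : B - l%:M = diag_mx (\row_i ((mu i)^-1 - l)).
    by apply/matrixP => i j; rewrite !mxE mulrnBl.
  rewrite det_diag; split=> [/prodf_eq0[i _]|[i ->]].
    by rewrite mxE subr_eq0 => /eqP <-; exists i.
  by rewrite (bigD1 i)//= mxE subrr mul0r.
by rewrite lef_pV2 ?posrE.
Qed.

End Diagonal.
End Spectrum.

(** * The rank of a trace ratio, and extended eigenvalues as real inverses *)

Section Bracket.
Context (R : realType).
Implicit Type alpha : R.

(** The bracketing integer exists and is unique for every [alpha], being given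
    by a ceiling. *)
Lemma bracketP alpha p : bracket alpha p <-> p = Num.ceil alpha^-1 - 1.
Proof.
have -> : bracket alpha p = (Num.ceil alpha^-1 == p + 1) :> Prop.
  by rewrite ceil_eq addrK intrD.
by rewrite -subr_eq eq_sym; split => /eqP.
Qed.

Lemma bracket_qOf alpha p : bracket alpha p <-> p = qOf alpha.
Proof.
have : bracket alpha (qOf alpha).
  rewrite /qOf; apply: (xgetPex (P := [set q | bracket alpha q]) 0).
  by exists (Num.ceil alpha^-1 - 1); apply/bracketP.
by move=> /bracketP ->; exact: bracketP.
Qed.

Lemma qOf_nat alpha (q : nat) : 0 < alpha ->
  q%:R * alpha < 1 <= (q%:R + 1) * alpha -> qOf alpha = q%:Z.
Proof.
move=> a0 /andP[qa aq]; apply/esym/bracket_qOf; apply/andP; split.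
  by rewrite -div1r ltr_pdivlMr.
by rewrite -div1r ler_pdivrMr.
Qed.

Lemma qOf_natP alpha : 0 < alpha < 1 -> exists q : nat,
  [/\ (0 < q)%N, q%:R * alpha < 1 <= (q%:R + 1) * alpha & qOf alpha = q%:Z].
Proof.
move=> /andP[a0 a1].
have qP : bracket alpha (qOf alpha) by apply/bracket_qOf.
have : 0 < qOf alpha.
  by have /bracketP -> := qP; rewrite subr_gt0 ceil_gt_int invf_gt1.
case: (qOf alpha) qP => // q /andP[qa aq] q0; exists q; split => //.
by rewrite -ltr_pdivlMr// -ler_pdivrMr// div1r qa aq.
Qed.

End Bracket.

Section ExtendedInverse.
Context (R : realType).
Implicit Type u v : R.
Local Open Scope ereal_scope.

Lemma inve_EFin_gt0 u : (0 <= u)%R -> 0 < u%:E^-1.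
Proof.
rewrite inver le_eqVlt => /orP[/eqP <-|u0]; first by rewrite eqxx ltry.
by rewrite gt_eqF// lte_fin invr_gt0.
Qed.

Lemma inve_sqr_inve u : (0 <= u)%R -> (u%:E^-1 ^+ 2)^-1 = (u ^+ 2)%:E.
Proof.
rewrite expe2 !inver le_eqVlt => /orP[/eqP <-|u0].
  by rewrite eqxx mulyy invey expr0n.
by rewrite gt_eqF// -EFinM inver gt_eqF ?mulr_gt0 ?invr_gt0// invfM !invrK expr2.
Qed.

Lemma le_inve_EFin u v : (0 <= u)%R -> (u <= v)%R -> v%:E^-1 <= u%:E^-1.
Proof.
rewrite !inver le_eqVlt => /orP[/eqP <-|u0 uv]; first by rewrite eqxx leey.
have v0 : (0 < v)%R by exact: lt_le_trans uv.
by rewrite !gt_eqF// lee_fin lef_pV2.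
Qed.

Lemma gt0_inveP (x : \bar R) : 0 < x -> exists2 u, (0 <= u)%R & x = u%:E^-1.
Proof.
case: x => [r|_|]//; last by exists 0%R => //; rewrite inve0.
rewrite lte_fin => r0; exists r^-1%R; first by rewrite invr_ge0 ltW.
by rewrite inver gt_eqF ?invr_gt0// invrK.
Qed.

(** Extended eigenvalues in [(0, +oo]] correspond to nonnegative real inverses,
    with order reversed and [+oo] matching 0. *)
Lemma smallestEntriesP (m : nat) (a b : R) (l : \bar R) :
  smallestEntries m a b l <-> exists mu : 'I_m -> R,
    [/\ forall i j : 'I_m, (i <= j)%N -> (mu i <= mu j)%R,
        forall i, (0 <= mu i)%R, (\sum_i mu i = a)%R, (\sum_i mu i ^+ 2 = b)%R
      & exists k : 'I_m, k.+1 = m /\ l = (mu k)%:E^-1].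
Proof.
split.
  move=> [lam [lam_mono lam0 + + [k [km ->]]]].
  have /choice[mu muP] : forall i, exists u, (0 <= u)%R /\ lam i = u%:E^-1.
    by move=> i; have [u] := gt0_inveP (lam0 i); exists u.
  have mu0 i : (0 <= mu i)%R by case: (muP i).
  have lamE i : lam i = (mu i)%:E^-1 by case: (muP i).
  under eq_bigr do rewrite lamE inveK.
  under [in X in _ -> X -> _]eq_bigr do rewrite lamE inve_sqr_inve//.
  rewrite !sumEFin => -[Sa] [Sb]; exists mu; split=> //.
    move=> i j /lam_mono; rewrite !lamE -lee_fin -[X in X <= _]inveK.
    by rewrite -[X in _ <= X]inveK -inve_pge// ?inveK ?inE ?inve_ge0 ?lee_fin.
  by exists k; rewrite lamE.
move=> [mu [mu_mono mu0 Sa Sb [k [km ->]]]].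
exists (fun i => (mu i)%:E^-1); split.
- by move=> i j /mu_mono; exact: le_inve_EFin.
- by move=> i; exact: inve_EFin_gt0.
- by under eq_bigr do rewrite inveK; rewrite sumEFin Sa.
- by under eq_bigr do rewrite inve_sqr_inve//; rewrite sumEFin Sb.
- by exists k.
Qed.
End ExtendedInverse.

(** * Extremal and nearly extremal tuples *)

Section Block.
Context (R : realType).

(** The shape of extremal tuples: [k] zero or small entries [e], the remainder
    [r], and [q] maximal entries [M]. *)
Definition block (k q : nat) (e r M : R) (i : 'I_(k + q.+1)) : R :=
  if (i < k)%N then e else if i == k :> nat then r else M.

Lemma sum_block k q e r M (F : R -> R) :
  \sum_(i < k + q.+1) F (block e r M i) = k%:R * F e + (F r + q%:R * F M).
Proof.
rewrite big_split_ord big_ord_recl /=; congr (_ + _); last congr (_ + _).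
- rewrite (eq_bigr (fun=> F e)) => [|i _]; last by rewrite /block /= ltn_ord.
  by rewrite sumr_const card_ord mulr_natl.
- by rewrite /block /= addn0 ltnn eqxx.
- rewrite (eq_bigr (fun=> F M)) => [|i _].
    by rewrite sumr_const card_ord mulr_natl.
  rewrite /block /= /bump /= ifF; last by apply/negbTE; lia.
  by rewrite ifF//; apply/negbTE; lia.
Qed.

Lemma block_gt0 k q e r M i : 0 < r -> 0 < M -> ((k == 0)%N || (0 < e)) ->
  0 < @block k q e r M i.
Proof.
rewrite /block; case: ltnP => [ik|_]; last by case: ifP.
by move=> _ _; case: k i ik.
Qed.

Lemma block_le k q e r M i : e <= M -> r <= M -> @block k q e r M i <= M.
Proof. by rewrite /block; case: ltnP => _ //; case: ifP. Qed.

Lemma block_mono k q e r M (i j : 'I_(k + q.+1)) : e <= r -> r <= M -> (i <= j)%N ->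
  @block k q e r M i <= @block k q e r M j.
Proof.
move=> er rM; have eM := le_trans er rM; rewrite /block.
case: (ltnP j k) => jk; case: (ltnP i k) => ik ij //.
- by have := leq_trans ik ij; rewrite leqNgt jk.
- by case: ifP.
- case: (eqVneq (i : nat) k) => [ik'|ik'].
    by case: ifP.
  by case: eqVneq => // jk'; lia.
Qed.

Lemma block_last k q e r M (i : 'I_(k + q.+1)) : (0 < q)%N ->
  i.+1 = (k + q.+1)%N -> block e r M i = M.
Proof.
move=> q0 ilast; rewrite /block ifF; last by apply/negbTE; lia.
by rewrite ifF//; apply/negbTE; lia.
Qed.

(** Once [k] entries are set to [e], the other [q + 1] must realize the reduced
    sums; the extremal shape for these does so exactly. *)
Section PeakBlock.
Context (k q : nat) (e a b : R).
Local Notation a' := (a - k%:R * e).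
Local Notation b' := (b - k%:R * e ^+ 2).
Local Notation M' := (peak q a' b').
Local Notation mu := (@block k q e (a' - q%:R * M') M').
Hypotheses (q0 : (0 < q)%N) (a0 : 0 < a') (qa : q%:R * b' < a' ^+ 2)
  (aq : a' ^+ 2 <= (q%:R + 1) * b').

Lemma sum_peak_block : \sum_i mu i = a.
Proof. by rewrite (sum_block _ _ _ _ _ id) /=; ring. Qed.

Lemma sum_sqr_peak_block : \sum_i mu i ^+ 2 = b.
Proof.
rewrite (sum_block _ _ _ _ _ (fun x => x ^+ 2)).
by rewrite [X in _ + X]addrC peak_sum//; ring.
Qed.

End PeakBlock.

(** The maximum is attained with all [k = m - q - 1] small entries equal to 0,
    that is, with [k] infinite eigenvalues. *)
Lemma smallestEntries_max (m q : nat) (a b : R) :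
  (0 < q < m)%N -> 0 < a -> q%:R * b < a ^+ 2 -> a ^+ 2 <= (q%:R + 1) * b ->
  smallestEntries m a b (peak q a b)^-1%:E /\
  ubound (smallestEntries m a b) (peak q a b)^-1%:E.
Proof.
move=> /andP[q0 qm] a0 qa aq.
have M0 : 0 < peak q a b by exact: peak_gt0.
split; [apply/smallestEntriesP|move=> l /smallestEntriesP].
  have mE : m = (m - q.+1 + q.+1)%N by lia.
  rewrite mE; set k := (m - q.+1)%N.
  have r0 := peak_rest_gt0 q0 a0 qa aq; 
  have rM : a - q%:R * peak q a b <= peak q a b by exact: peak_rest_le.
  pose mu := @block k q 0 (a - q%:R * peak q a b) (peak q a b).
  exists mu; split.
  - by move=> i j; apply: block_mono => //; exact: ltW.
  - move=> i; rewrite /mu /block; case: ifP => // _.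
    by case: ifP => _; exact: ltW.
  - have := @sum_peak_block k q 0 a b; rewrite expr0n /= !mulr0 !subr0; exact.
  - by have := @sum_sqr_peak_block k q 0 a b; rewrite expr0n /= !mulr0 !subr0; exact.
  - have km : (k + q < k + q.+1)%N by rewrite addnS.
    exists (Ordinal km); split => /=; first by rewrite addnS.
    by rewrite /mu block_last//= ?addnS// inver gt_eqF.
move=> [mu [mu_mono mu0 Sa Sb [k [km ->]]]].
have muk i : mu i <= mu k by apply: mu_mono; rewrite -ltnS km.
have MN : peak q a b <= mu k.
  by apply: (@peak_min _ _ a b q0 a0 aq _ mu) => // i; rewrite mu0 muk.
have N0 := lt_le_trans M0 MN.
by rewrite inver gt_eqF// lee_fin lef_pV2.
Qed.

Lemma maxSmallestEigE (m q : nat) (A : 'M[R]_m) (a := invTrace A)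
    (b := invSqTrace A) :
  (0 < q < m)%N -> 0 < a -> q%:R * b < a ^+ 2 -> a ^+ 2 <= (q%:R + 1) * b ->
  maxSmallestEig A = (peak q a b)^-1.
Proof.
move=> qm a0 qa aq; have [mem ub] := smallestEntries_max qm a0 qa aq.
rewrite /maxSmallestEig; have -> : ereal_sup (smallestEntries m a b) = (peak q a b)^-1%:E.
  by apply/le_anti; rewrite ge_ereal_sup//= ereal_sup_ubound.
by [].
Qed.

Lemma peak_attained (m q : nat) (a b : R) :
  q.+1 = m -> (0 < q)%N -> 0 < a -> q%:R * b < a ^+ 2 ->
  a ^+ 2 <= (q%:R + 1) * b ->
  exists mu : 'I_m -> R, [/\ forall i, 0 < mu i, \sum_i mu i = a,
    \sum_i mu i ^+ 2 = b &
    exists i0, (forall i, mu i <= mu i0) /\ mu i0 = peak q a b].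
Proof.
move=> <- q0 a0 qa aq; pose M := peak q a b; pose r := a - q%:R * M.
have M0 : 0 < M by exact: peak_gt0.
exists (@block 0 q 0 r M); split.
- by move=> i; apply: block_gt0 => //; exact: peak_rest_gt0.
- have := @sum_peak_block 0 q 0 a b; rewrite !mul0r !subr0; exact.
- by have := @sum_sqr_peak_block 0 q 0 a b; rewrite !mul0r !subr0; exact.
- have lastE : @block 0 q 0 r M ord_max = M by rewrite block_last.
  exists ord_max; split => [i|//]; rewrite lastE block_le//; first exact: ltW.
  exact: peak_rest_le.
Qed.

(** The zeros of the extremal tuple are replaced by a small [e > 0].  For small
    [e] the reduced sums still satisfy the bracketing inequalities for [q], and
    their peak depends continuously on [e]. *)
Lemma peak_approached (m q : nat) (a b eps : R) :
  (0 < q)%N -> (q.+1 < m)%N -> 0 < a -> q%:R * b < a ^+ 2 ->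
  a ^+ 2 <= (q%:R + 1) * b -> 0 < eps ->
  exists mu : 'I_m -> R, [/\ forall i, 0 < mu i, \sum_i mu i = a,
    \sum_i mu i ^+ 2 = b &
    exists i0, (forall i, mu i <= mu i0) /\ mu i0 < peak q a b + eps].
Proof.
move=> q0 qm a0 qa aq eps0.
pose k := (m - q.+1)%N; have mE : m = (k + q.+1)%N by rewrite /k; lia.
rewrite {}mE {qm}; move: k => k {m}.
pose a' (e : R) := a - k%:R * e; pose b' (e : R) := b - k%:R * e ^+ 2.
pose M (e : R) := peak q (a' e) (b' e).
have a'c : continuous a'.
  move=> e; apply: cvgB; first exact: cvg_cst.
  by apply: cvgMr; exact: cvg_id.
have b'c : continuous b'.
  move=> e; apply: cvgB; first exact: cvg_cst.
  by apply: cvgMr; exact: exprn_continuous.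
have Mc : continuous M.
  move=> e; apply: cvgMl; apply: cvgD; first by apply: cvgMl; exact: a'c.
  apply: continuous_cvg; first exact: sqrt_continuous.
  apply: cvgMr; apply: cvgB; first by apply: cvgMr; exact: b'c.
  by rewrite expr2; under eq_fun do rewrite expr2; apply: cvgM; exact: a'c.
have at0 (f : R -> R) : continuous f -> f e @[e --> 0^'+] --> f 0.
  by move=> fc; apply: cvg_at_right_filter; exact: fc.
have a'0 : a' 0 = a by rewrite /a' mulr0 subr0.
have b'0 : b' 0 = b by rewrite /b' expr0n /= mulr0 subr0.
have M0 : M 0 = peak q a b by rewrite /M a'0 b'0.
have Mpos : 0 < peak q a b by exact: peak_gt0.
near (0 : R)^'+ => e.
have e0 : 0 < e by near: e; exact: nbhs_right_gt.
have a'gt0 : 0 < a' e.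
  near: e; apply: (cvgr_gt (a' 0)); last by rewrite a'0.
  exact: at0.
have qa' : q%:R * b' e < a' e ^+ 2.
  rewrite -subr_gt0; near: e.
  apply: (cvgr_gt (a' 0 ^+ 2 - q%:R * b' 0)); last by rewrite a'0 b'0 subr_gt0.
  apply: (at0 (fun e => a' e ^+ 2 - q%:R * b' e)) => e; apply: cvgB.
    by rewrite expr2; under eq_fun do rewrite expr2; apply: cvgM; exact: a'c.
  by apply: cvgMr; exact: b'c.
have aq' : a' e ^+ 2 <= (q%:R + 1) * b' e.
  (* Continuity is not enough here, as equality may hold at [e = 0]; this product
     is the exact amount by which [(q + 1) * b' - a'^2] increases. *)
  have : 0 <= k%:R * e * (2 * a - (k + q.+1)%:R * e).
    rewrite !mulr_ge0 ?(ltW e0)// subr_ge0 mulrC -ler_pdivlMr ?ltr0n ?addnS//.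
    by near: e; apply: nbhs_right_le; rewrite divr_gt0 ?mulr_gt0 ?ltr0n ?addnS.
  rewrite /a' /b' natrD -natr1; lra.
have eM : e <= M e.
  rewrite ltW// -subr_gt0; near: e.
  apply: (cvgr_gt (M 0 - 0)); last by rewrite M0 subr0.
  by apply: (at0 (fun e => M e - e)) => e; apply: cvgB; [exact: Mc|exact: cvg_id].
have Meps : M e < peak q a b + eps.
  near: e; apply: (cvgr_lt (M 0)); last by rewrite M0 ltrDl.
  exact: at0.
exists (@block k q e (a' e - q%:R * M e) (M e)); split.
- by move=> i; apply: block_gt0; rewrite ?e0 ?orbT//; [exact: peak_rest_gt0|exact: peak_gt0].
- exact: sum_peak_block.
- exact: sum_sqr_peak_block.
- have km : (k + q < k + q.+1)%N by rewrite addnS.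
  exists (Ordinal km); rewrite block_last//= ?addnS//.
  by split=> [i|//]; apply: block_le => //; exact: peak_rest_le.
Unshelve. all: by end_near.
Qed.

End Block.

(** * The ratio formula *)

Section Traces.
Context (R : realType).

Lemma sqr_sum_le (m : nat) (mu : 'I_m -> R) :
  (\sum_i mu i) ^+ 2 <= m%:R * \sum_i mu i ^+ 2.
Proof.
case: m mu => [|m] mu; first by rewrite !big_ord0 expr0n mulr0.
set S := \sum_i mu i; set S2 := \sum_i _ ^+ 2; pose n : R := m.+1%:R.
have n0 : 0 < n by rewrite ltr0n.
(* The variance of the entries, scaled by a power of the size. *)
have : 0 <= \sum_i (n * mu i - S) ^+ 2 by rewrite sumr_ge0// => i _; exact: sqr_ge0.
have -> : \sum_i (n * mu i - S) ^+ 2 = n * (n * S2 - S ^+ 2).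
  rewrite (eq_bigr (fun i => n ^+ 2 * mu i ^+ 2 + ((- (2 * n * S)) * mu i + S ^+ 2))).
    rewrite !big_split /= -!mulr_sumr sumr_const card_ord -/S -/S2 -mulr_natl -/n.
    ring.
  by move=> i _; ring.
by rewrite pmulr_rge0// subr_ge0.
Qed.

Lemma traces_bounds (m : nat) (A : 'M[R]_m) (a := invTrace A)
    (b := invSqTrace A) : (1 < m)%N -> symposdefmx A ->
  [/\ 0 < a, b < a ^+ 2 & a ^+ 2 <= m%:R * b].
Proof.
move=> m1 Apd; have [d [d0 _ aE bE]] := symposdef_spectrum Apd.
pose mu i := (d i)^-1.
have mu0 i : 0 < mu i by rewrite invr_gt0.
have mu_a i : mu i <= a.
  by rewrite /a aE (bigD1 i)//= lerDl sumr_ge0// => j _; exact: ltW (mu0 j).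
have a0 : 0 < a by exact: lt_le_trans (mu0 (Ordinal m1)) (mu_a _).
split => //; last by rewrite /a /b aE bE; exact: sqr_sum_le.
have mu_itv i : 0 < mu i <= a by rewrite mu0 mu_a.
(* With [N = a] and [q = 0] the left-hand side vanishes, which leaves
   [0 < a^2 - b]. *)
have := sum_sqr_defect_lt mu_itv (ltW a0) m1.
rewrite -aE -bE -/a -/b => defect; lra.
Qed.

Lemma traces_qOf (m : nat) (A : 'M[R]_m) (a := invTrace A)
    (b := invSqTrace A) : (1 < m)%N -> symposdefmx A ->
  exists q : nat, [/\ (0 < q < m)%N, 0 < a, q%:R * b < a ^+ 2,
    a ^+ 2 <= (q%:R + 1) * b & qOf (traceRatio A) = q%:Z].
Proof.
move=> m1 Apd; have [a0 ba am] := traces_bounds m1 Apd; rewrite -/a -/b in a0 ba am.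
have a2 : 0 < a ^+ 2 by exact: exprn_gt0.
have b0 : 0 < b.
  by have := lt_le_trans a2 am; rewrite pmulr_rgt0// ltr0n ltnW.
have [|q [q0 /andP[qa aq] qE]] := @qOf_natP _ (traceRatio A).
  by rewrite /traceRatio divr_gt0//= ltr_pdivrMr// mul1r.
exists q; split => //.
- rewrite q0 -(ltr_nat R) -(ltr_pM2r b0) (lt_le_trans _ am)//.
  by move: qa; rewrite /traceRatio mulrA ltr_pdivrMr// mul1r.
- by move: qa; rewrite /traceRatio mulrA ltr_pdivrMr// mul1r.
- by move: aq; rewrite /traceRatio mulrA ler_pdivlMr// mul1r.
Qed.

(** The square root in the peak is [a] times the one in the gap ratio. *)
Lemma laguerre_peak (m q : nat) (A : 'M[R]_m) :
  (0 < q)%N -> 0 < invTrace A -> qOf (traceRatio A) = q%:Z ->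
  laguerreBound A * peak q (invTrace A) (invSqTrace A) =
  gapRatio m (traceRatio A).
Proof.
move=> q0 a0 qE; rewrite /laguerreBound /gapRatio qE /peak -/(traceRatio A).
set al := traceRatio A; set a := invTrace A; rewrite -/a in a0.
have bE : invSqTrace A = a ^+ 2 * al by rewrite /al /traceRatio mulrCA mulfV ?mulr1// expf_eq0 gt_eqF.
have -> : q%:R * ((q%:R + 1) * invSqTrace A - a ^+ 2) =
  a ^+ 2 * (q%:R * ((q%:R + 1) * al - 1)) by rewrite bE; ring.
rewrite [Num.sqrt (a ^+ 2 * _)]sqrtrM ?sqr_ge0// sqrtr_sqr gtr0_norm// -pmulrn.
set s := Num.sqrt _; set t := Num.sqrt _; have s0 : 0 <= s by exact: sqrtr_ge0.
have Q0 : 0 < (q%:R : R) by rewrite ltr0n.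
have s1 : 1 + s != 0 by rewrite gt_eqF// ltr_wpDr.
have Q1 : (q%:R + 1 : R) != 0 by rewrite gt_eqF// addr_gt0.
by field; rewrite s1 Q1 !gt_eqF.
Qed.

Lemma laguerre_gt0 (m : nat) (A : 'M[R]_m) :
  (0 < m)%N -> 0 < invTrace A -> 0 < laguerreBound A.
Proof.
move=> m0 a0; by rewrite /laguerreBound mulr_gt0 ?invr_gt0// divr_gt0 ?ltr0n// ltr_wpDr.
Qed.

Lemma laguerre_congr (m : nat) (A B : 'M[R]_m) :
  invTrace A = invTrace B -> invSqTrace A = invSqTrace B ->
  laguerreBound A = laguerreBound B.
Proof. by rewrite /laguerreBound => -> ->. Qed.

(** The largest inverse eigenvalue is a bound [N] for the extremal inequality,
    strict because finite eigenvalues have nonzero inverses. *)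
Lemma smallestEig_peak (m q : nat) (A : 'M[R]_m) (a := invTrace A)
    (b := invSqTrace A) : symposdefmx A ->
  (0 < q < m)%N -> 0 < a -> q%:R * b < a ^+ 2 -> a ^+ 2 <= (q%:R + 1) * b ->
  [/\ 0 < smallestEig A, peak q a b <= (smallestEig A)^-1 &
    (q.+1 < m)%N -> peak q a b < (smallestEig A)^-1].
Proof.
move=> Apd /andP[q0 qm] a0 qa aq; have [d [d0 eigE aE bE]] := symposdef_spectrum Apd.
have i1 : 'I_m := Ordinal (leq_ltn_trans (leq0n q) qm).
have [i0 dmin] : exists i0, forall i, d i0 <= d i.
  by case: (arg_minP d (i0 := i1) (P := predT) isT) => i0 _ dmin; exists i0 => i; exact: dmin.
rewrite (smallestEigE eigE dmin).
have mu i : 0 < (d i)^-1 <= (d i0)^-1.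
  by rewrite invr_gt0 d0 lef_pV2 ?posrE ?d0 ?dmin.
have N0 : 0 <= (d i0)^-1 by rewrite invr_ge0 ltW.
split=> // [|qm'].
  apply: (@peak_min _ _ a b q0 a0 aq _ _ _ _ N0 (esym aE) (esym bE)) => i.
  by case/andP: (mu i) => /ltW -> ->.
exact: (@peak_lt _ _ a b q0 a0 aq _ _ _ mu N0 qm' (esym aE) (esym bE)).
Qed.

Lemma diag_ratio (m : nat) (A : 'M[R]_m) (mu : 'I_m -> R) (i0 : 'I_m)
    (B := diag_mx (\row_i (mu i)^-1)) :
  (forall i, 0 < mu i) -> \sum_i mu i = invTrace A ->
  \sum_i mu i ^+ 2 = invSqTrace A -> (forall i, mu i <= mu i0) ->
  [/\ symposdefmx B, invTrace B = invTrace A, invSqTrace B = invSqTrace A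
    & laguerreBound B / smallestEig B = laguerreBound A * mu i0].
Proof.
move=> mu0 Sa Sb mumax.
have aE : invTrace B = invTrace A by rewrite diag_invTrace.
have bE : invSqTrace B = invSqTrace A by rewrite diag_invSqTrace.
split => //; first exact: diag_symposdef.
by rewrite (laguerre_congr aE bE) (diag_smallestEig mu0 mumax) invrK.
Qed.

Lemma ratio_max_smallestEig (m : nat) (A : 'M[R]_m) :
  (1 < m)%N -> symposdefmx A ->
  laguerreBound A / maxSmallestEig A = gapRatio m (traceRatio A).
Proof.
move=> m1 Apd; have [q [qm a0 qa aq qE]] := traces_qOf m1 Apd.
have /andP[q0 _] := qm.
by rewrite (maxSmallestEigE qm)// invrK laguerre_peak.
Qed.

Lemma laguerre_ratio (m : nat) (A : 'M[R]_m) : (1 < m)%N -> symposdefmx A ->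
     let alpha := traceRatio A in
     let q := qOf alpha in
     [/\ m%:R^-1 <= alpha < 1,
         forall p : int, bracket alpha p <-> p = q,
         smallestEntries m (invTrace A) (invSqTrace A) (maxSmallestEig A)%:E /\
         ubound (smallestEntries m (invTrace A) (invSqTrace A))
           (maxSmallestEig A)%:E,
         laguerreBound A / maxSmallestEig A = gapRatio m alpha
       & [/\ gapRatio m alpha <= laguerreBound A / smallestEig A,
             q <> m%:Z - 1 ->
               gapRatio m alpha < laguerreBound A / smallestEig A /\
               forall eps : R, 0 < eps -> exists B : 'M[R]_m,
                 [/\ symposdefmx B, invTrace B = invTrace A,
                     invSqTrace B = invSqTrace A
                   & laguerreBound B / smallestEig B < gapRatio m alpha + eps]
           & q = m%:Z - 1 ->
               exists B : 'M[R]_m,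
                 [/\ symposdefmx B, invTrace B = invTrace A,
                     invSqTrace B = invSqTrace A
                   & laguerreBound B / smallestEig B = gapRatio m alpha]]].
Proof.
move=> m1 Apd; have [q [qm a0 qa aq qE]] := traces_qOf m1 Apd.
have /andP[q0 qm'] := qm.
have [_ ba am] := traces_bounds m1 Apd.
have L0 : 0 < laguerreBound A by rewrite laguerre_gt0// ltnW.
have gapE := laguerre_peak q0 a0 qE.
have [l0 Ml Ml'] := smallestEig_peak Apd qm a0 qa aq.
split.
- have a2 : 0 < invTrace A ^+ 2 by exact: exprn_gt0.
  rewrite /traceRatio ltr_pdivrMr// mul1r ba andbT.
  by rewrite ler_pdivlMr// mulrC ler_pdivrMr ?ltr0n 1?ltnW// mulrC.
- by move=> p; exact: bracket_qOf.
- by rewrite (maxSmallestEigE qm)//; exact: smallestEntries_max.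
- exact: ratio_max_smallestEig.
rewrite qE -gapE; split.
- by rewrite ler_pM2l.
- move=> qm1; have {qm1}qm1 : (q.+1 < m)%N by lia.
  split; first by rewrite ltr_pM2l// Ml'.
  move=> eps eps0; have eps0' : 0 < eps / laguerreBound A by rewrite divr_gt0.
  have [mu [mu0 Sa Sb [i0 [mumax mui0]]]] := peak_approached q0 qm1 a0 qa aq eps0'.
  have [Bpd Ba Bb BE] := diag_ratio mu0 Sa Sb mumax.
  eexists; split; [exact: Bpd|exact: Ba|exact: Bb|rewrite BE].
  by rewrite -(ltr_pM2l L0) mulrDr [_ * (eps / _)]mulrC divfK ?gt_eqF// in mui0.
- move=> qm1; have {}qm1 : q.+1 = m by lia.
  have [mu [mu0 Sa Sb [i0 [mumax mui0]]]] := peak_attained qm1 q0 a0 qa aq.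
  have [Bpd Ba Bb BE] := diag_ratio mu0 Sa Sb mumax.
  by eexists; split; [exact: Bpd|exact: Ba|exact: Bb|rewrite BE mui0].
Qed.

End Traces.

(** * The regions near 1/m and above 1/2 *)

Section Regions.
Context (R : realType).

Definition gapLow (m : nat) (x : R) : R :=
  (m%:R - 1)^-1 *
  (1 + (m%:R - 2) / (1 + Num.sqrt ((m%:R - 1) * (m%:R * x - 1)))).

Definition gapHigh (m : nat) (x : R) : R :=
  m%:R / 2 * ((1 + Num.sqrt (2 * x - 1)) /
              (1 + Num.sqrt ((m%:R - 1) * (m%:R * x - 1)))).

Lemma continuous_sqrt_affine (c d e : R) :
  continuous (fun x : R => Num.sqrt (c * (d * x - e))).
Proof.
move=> x; apply: continuous_cvg; first exact: sqrt_continuous.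
by apply: cvgMr; apply: cvgB; [apply: cvgMr; exact: cvg_id|exact: cvg_cst].
Qed.

Lemma one_sqrt_gt0 (y : R) : 0 < 1 + Num.sqrt y.
Proof. by rewrite ltr_wpDr ?sqrtr_ge0. Qed.

Lemma gapLow_continuous m : continuous (gapLow m).
Proof.
move=> x; apply: cvgMr; apply: cvgD; first exact: cvg_cst.
apply: cvgMr; apply: cvgV; first by rewrite gt_eqF// one_sqrt_gt0.
by apply: cvgD; [exact: cvg_cst|exact: continuous_sqrt_affine].
Qed.

Lemma gapHigh_continuous m : continuous (gapHigh m).
Proof.
move=> x; apply: cvgMr; apply: cvgM.
  apply: cvgD; first exact: cvg_cst.
  have -> : (fun y => Num.sqrt (2 * y - 1)) =
      (fun y : R => Num.sqrt (1 * (2 * y - 1))) by apply/funext => y; rewrite mul1r.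
  by rewrite -[2 * x - 1]mul1r; exact: continuous_sqrt_affine.
apply: cvgV; first by rewrite gt_eqF// one_sqrt_gt0.
by apply: cvgD; [exact: cvg_cst|exact: continuous_sqrt_affine].
Qed.

Section FixedSize.
Context (m : nat) (m1 : (1 < m)%N).
Local Notation n := (m%:R : R).
Local Notation s x := (Num.sqrt ((n - 1) * (n * x - 1))).

Let n1 : 1 < n. Proof. by rewrite ltr1n. Qed.
Let n2 : 2 <= n. Proof. by rewrite ler_nat. Qed.
Let n0 : 0 < n. Proof. by rewrite ltr0n ltnW. Qed.
Let np : 0 < n - 1. Proof. by rewrite subr_gt0. Qed.

Lemma qOf_low x : n^-1 <= x < (n - 1)^-1 -> qOf x = m%:Z - 1.
Proof.
move=> /andP[nx xn]; have x0 : 0 < x by rewrite (lt_le_trans _ nx)// invr_gt0.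
rewrite (@qOf_nat _ _ m.-1)//; first by lia.
have -> : (m.-1%:R : R) = n - 1 by rewrite -subn1 natrB// ltnW.
by rewrite subrK mulrC -ltr_pdivlMr// mul1r xn/= mulrC -ler_pdivrMr// mul1r.
Qed.

Lemma gapRatio_low x : n^-1 <= x < (n - 1)^-1 -> gapRatio m x = gapLow m x.
Proof.
move=> xI; rewrite /gapRatio /gapLow (qOf_low xI) rmorphB /= -pmulrn subrK.
have s1 := one_sqrt_gt0 ((n - 1) * (n * x - 1)).
set t := Num.sqrt _ in s1 *.
by field; rewrite !gt_eqF.
Qed.

Lemma sqrt_low_lt x y : n^-1 <= x -> x < y -> s x < s y.
Proof.
move=> nx xy.
have hx : 1 <= n * x by rewrite mulrC -ler_pdivrMr// mul1r.
have hy : n * x < n * y by rewrite ltr_pM2l.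
by rewrite ltr_sqrt ?ltr_pM2l// ?ltrD2r// mulr_gt0// subr_gt0 (le_lt_trans hx).
Qed.

(** Only the inner square root depends on the argument; the coefficient
    [m - 2] vanishes for [m = 2]. *)
Lemma gapLow_decr x y : n^-1 <= x -> x < y ->
  gapLow m y <= gapLow m x /\ ((2 < m)%N -> gapLow m y < gapLow m x).
Proof.
move=> nx xy; have sxy := sqrt_low_lt nx xy.
have sx1 := one_sqrt_gt0 ((n - 1) * (n * x - 1)).
have sy1 := one_sqrt_gt0 ((n - 1) * (n * y - 1)).
have sV : (1 + s y)^-1 < (1 + s x)^-1 by rewrite ltf_pV2 ?posrE// ltrD2l.
split=> [|m2]; rewrite /gapLow.
  rewrite ler_pM2l ?invr_gt0// lerD2l ler_wpM2l ?subr_ge0//; exact: ltW.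
by rewrite ltr_pM2l ?invr_gt0// ltrD2l ltr_pM2l// subr_gt0 ltr_nat.
Qed.

Lemma gapLow_left : gapLow m n^-1 = 1.
Proof.
rewrite /gapLow mulfV ?gt_eqF// subrr mulr0 sqrtr0 addr0.
by field; rewrite gt_eqF.
Qed.

Lemma gapLow_right : gapLow m (n - 1)^-1 = 2^-1 * (n / (n - 1)).
Proof.
rewrite /gapLow; have -> : (n - 1) * (n / (n - 1) - 1) = 1 by field; rewrite gt_eqF.
by rewrite sqrtr1; field; rewrite gt_eqF.
Qed.

Lemma inv_pred_gt : n^-1 < (n - 1)^-1.
Proof. by rewrite ltf_pV2 ?posrE// gtrBl. Qed.

Lemma gapLow_gt_half x : n^-1 <= x < (n - 1)^-1 -> 2^-1 < gapLow m x.
Proof.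
move=> /andP[nx xn]; have [le _] := gapLow_decr nx xn.
apply: lt_le_trans le; rewrite gapLow_right ltr_pMr ?invr_gt0//.
by rewrite ltr_pdivlMr// mul1r gtrBl.
Qed.

Lemma gapLow_le1 x : n^-1 <= x -> gapLow m x <= 1.
Proof.
rewrite le_eqVlt => /orP[/eqP <-|nx]; first by rewrite gapLow_left.
by have [] := gapLow_decr (lexx _) nx; rewrite gapLow_left.
Qed.

Lemma gapRatio_cvg_low_left :
  gapRatio m x @[x --> ((n - 1)^-1 : R)^'-] --> (2^-1 * (n / (n - 1)) : R).
Proof.
rewrite -gapLow_right; apply: (@cvg_trans _ (gapLow m x @[x --> ((n - 1)^-1)^'-])).
  apply: near_eq_cvg; near=> x; rewrite gapRatio_low//; apply/andP; split.
    by near: x; apply: nbhs_left_ge; exact: inv_pred_gt.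
  by near: x; exact: nbhs_left_lt.
by apply: cvg_at_left_filter; exact: gapLow_continuous.
Unshelve. all: by end_near.
Qed.

Lemma gapRatio_cvg_low_right :
  gapRatio m x @[x --> (n^-1 : R)^'+] --> (1 : R).
Proof.
rewrite -{2}gapLow_left; apply: (@cvg_trans _ (gapLow m x @[x --> (n^-1)^'+])).
  apply: near_eq_cvg; near=> x; rewrite gapRatio_low//; apply/andP; split.
    by near: x; exact: nbhs_right_ge.
  by near: x; apply: nbhs_right_lt; exact: inv_pred_gt.
by apply: cvg_at_right_filter; exact: gapLow_continuous.
Unshelve. all: by end_near.
Qed.

Lemma qOf_high (x : R) : 2^-1 <= x < 1 -> qOf x = 1.
Proof.
move=> /andP[hx x1]; have x0 : 0 < x by rewrite (lt_le_trans _ hx)// invr_gt0.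
by rewrite (@qOf_nat _ _ 1)// mul1r x1/=; lra.
Qed.

Lemma gapRatio_high x : 2^-1 <= x < 1 -> gapRatio m x = gapHigh m x.
Proof.
move=> xI; rewrite /gapRatio /gapHigh (qOf_high xI) !mul1r.
by have -> : 1%:~R + 1 = 2 :> R by [].
Qed.

(** With [u = sqrt (2 * x - 1)] the ratio is [(1 + u) / (1 + S u)], where
    [S u ^ 2] is a quadratic polynomial in [u ^ 2], so [S] is convex, with
    [S 1 = m - 1].  For [m > 2] and [u < 1] it lies strictly above its tangent
    at 1, that is, [S u > (m * u + m - 2) / 2], because
    [4 * S u ^ 2 - (m * u + m - 2) ^ 2 = m * (m - 2) * (1 - u) ^ 2]. *)
Lemma gapHigh_incr x y : 2^-1 <= x -> x < y -> y < 1 ->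
  gapHigh m x <= gapHigh m y /\ ((2 < m)%N -> gapHigh m x < gapHigh m y).
Proof.
move=> hx xy y1.
set u := Num.sqrt (2 * x - 1); set v := Num.sqrt (2 * y - 1).
have u2 : u ^+ 2 = 2 * x - 1 by rewrite sqr_sqrtr; lra.
have v2 : v ^+ 2 = 2 * y - 1 by rewrite sqr_sqrtr; lra.
have u0 : 0 <= u by exact: sqrtr_ge0.
have v0 : 0 <= v by exact: sqrtr_ge0.
have v1 : v < 1.
  by rewrite -[X in _ < X]sqrtr1 /v ltr_sqrt; lra.
have uv : u < v by rewrite /u /v ltr_sqrt; lra.
have [->|m2] := eqVneq m 2%N.
  rewrite /gapHigh -/u -/v.
  have e1 : (2 - 1 : R) = 1 by ring.
  by rewrite e1 !mul1r -/u -/v !divff ?gt_eqF ?one_sqrt_gt0.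
have {}m2 : (2 < m)%N by rewrite ltn_neqAle eq_sym m2.
have n3 : 2 < n by rewrite ltr_nat.
suff lt : gapHigh m x < gapHigh m y by split => //; exact: ltW.
have sx1 := one_sqrt_gt0 ((n - 1) * (n * x - 1)).
have sy1 := one_sqrt_gt0 ((n - 1) * (n * y - 1)).
have key z w : 2^-1 <= z -> w ^+ 2 = 2 * z - 1 -> 0 <= w < 1 ->
    n * w + n - 2 < 2 * s z /\ s z ^+ 2 = (n - 1) * (n * (w ^+ 2 + 1) / 2 - 1).
  move=> hz wE /andP[w0 w1].
  have zE : z = (w ^+ 2 + 1) / 2 by rewrite wE; lra.
  have s2 : s z ^+ 2 = (n - 1) * (n * (w ^+ 2 + 1) / 2 - 1).
    have nz : 0 <= n * z - 1.
      have : 2 * 2^-1 <= n * z by rewrite ler_pM// invr_ge0.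
      by rewrite mulfV// subr_ge0.
    by rewrite sqr_sqrtr ?mulr_ge0 ?(ltW np)// [in LHS]zE mulrA.
  split=> //; rewrite -(@ltr_pXn2r _ 2)// ?nnegrE.
  - rewrite exprMn s2 -subr_gt0.
    have -> : 2 ^+ 2 * ((n - 1) * (n * (w ^+ 2 + 1) / 2 - 1)) - (n * w + n - 2) ^+ 2
      = n * (n - 2) * (1 - w) ^+ 2 by field.
    by rewrite !mulr_gt0 ?exprn_gt0 ?subr_gt0.
  - by rewrite -addrA addr_ge0 ?mulr_ge0 ?(ltW n0)// subr_ge0.
  - by rewrite mulr_ge0 ?sqrtr_ge0.
have [sx sx2] := key x u hx u2 ltac:(by rewrite u0 (lt_trans uv)).
have [sy sy2] := key y v (ltW (le_lt_trans hx xy)) v2 ltac:(by rewrite v0).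
rewrite /gapHigh -/u -/v ltr_pM2l ?divr_gt0// ltr_pdivrMr// mulrAC ltr_pdivlMr//.
move: sx sy sx2 sy2 sx1 sy1; set S := s x; set T := s y.
move=> sx sy sx2 sy2 sx1 sy1.
(* After clearing denominators the claim is
   [(1 + u) * (T - S) < (v - u) * (1 + S)].  Multiplied by [T + S], its left-hand
   side becomes a polynomial in [u] and [v], and each factor on the right is
   bounded below by the estimates above. *)
have A1 : n * (1 + u) < 2 * (1 + S) by lra.
have A2 : 0 <= (n - 2) * (2 - (u + v)) by rewrite mulr_ge0; lra.
have A3 : (n - 1) * (u + v) < T + S by lra.
have A4 : n * (1 + u) * ((n - 1) * (u + v)) < 2 * (1 + S) * (T + S).
  by rewrite ltr_pM// mulr_ge0//; lra.
have TS : (T - S) * (T + S) = (n - 1) * n * (v - u) * (u + v) / 2.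
  have -> : (T - S) * (T + S) = T ^+ 2 - S ^+ 2 by ring.
  by rewrite sx2 sy2; field.
have TS0 : 0 < T + S by rewrite (le_lt_trans _ A3)// mulr_ge0; lra.
have A5 : (v - u) * (n * (1 + u) * ((n - 1) * (u + v))) <
    (v - u) * (2 * (1 + S) * (T + S)) by rewrite ltr_pM2l// subr_gt0.
have A6 : (1 + u) * (T - S) < (v - u) * (1 + S).
  rewrite -(ltr_pM2r TS0) -[X in X < _]mulrA TS; lra.
lra.
Qed.

Lemma gapHigh_left : gapHigh m 2^-1 = (Num.sqrt 2)^-1 *
  (Num.sqrt 2 / n + Num.sqrt ((1 - n^-1) * (1 - 2 / n)))^-1.
Proof.
rewrite /gapHigh mulfV// subrr sqrtr0 addr0 div1r.
have -> : (1 - n^-1) * (1 - 2 / n) = (2 / n ^+ 2) * ((n - 1) * (n / 2 - 1)).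
  by field; rewrite gt_eqF.
rewrite [Num.sqrt (2 / _ * _)]sqrtrM ?divr_ge0 ?exprn_ge0 ?(ltW n0)//.
rewrite [Num.sqrt (2 / _)]sqrtrM// sqrtrV ?exprn_ge0 ?(ltW n0)// sqrtr_sqr gtr0_norm//.
have s1 := one_sqrt_gt0 ((n - 1) * (n / 2 - 1)).
set t := Num.sqrt (_ * _) in s1 *.
have r0 : 0 < Num.sqrt (2 : R) by rewrite sqrtr_gt0.
have r2 : Num.sqrt (2 : R) ^+ 2 = 2 by rewrite sqr_sqrtr.
set r := Num.sqrt 2 in r0 r2 *.
have -> : r / n + r / n * t = r * (1 + t) / n by ring.
by rewrite -r2; field; rewrite !gt_eqF.
Qed.

Lemma gapHigh_right : gapHigh m 1 = 1.
Proof.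
rewrite /gapHigh; have -> : (n - 1) * (n * 1 - 1) = (n - 1) ^+ 2 by ring.
have -> : 2 * 1 - 1 = 1 :> R by ring.
rewrite sqrtr1 sqrtr_sqr gtr0_norm// [1 + (_ - _)]addrC subrK.
by field; rewrite gt_eqF.
Qed.

Lemma gapHigh_ge x : 2^-1 <= x < 1 -> gapHigh m 2^-1 <= gapHigh m x.
Proof.
move=> /andP[]; rewrite le_eqVlt => /orP[/eqP <-//|hx x1].
by have [] := gapHigh_incr (lexx _) hx x1.
Qed.

Lemma gapRatio_cvg_high : gapRatio m x @[x --> (1 : R)^'-] --> (1 : R).
Proof.
rewrite -{2}gapHigh_right; apply: (@cvg_trans _ (gapHigh m x @[x --> 1^'-])).
  apply: near_eq_cvg; near=> x; rewrite gapRatio_high//; apply/andP; split.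
    by near: x; apply: nbhs_left_ge; rewrite invf_lt1 ?ltr1n.
  by near: x; exact: nbhs_left_lt.
by apply: cvg_at_left_filter; exact: gapHigh_continuous.
Unshelve. all: by end_near.
Qed.

End FixedSize.
End Regions.

(** * Asymptotic behaviour *)

Section Asymptotics.
Context (R : realType).

Lemma invr_nat_cvg0 : (n%:R^-1 : R) @[n --> \oo] --> (0 : R).
Proof.
apply/gtr0_cvgV0; last exact: cvgr_idn.
by near=> n; rewrite ltr0n; near: n; exact: nbhs_infty_gt.
Unshelve. all: by end_near.
Qed.

(** The closed form at 1/2 is a continuous function of [1 / m]. *)
Lemma gapRatio_half_cvg :
  gapRatio m (2^-1 : R) @[m --> \oo] --> ((Num.sqrt 2)^-1 : R).
Proof.
pose F (u : R) := (Num.sqrt 2)^-1 * (Num.sqrt 2 * u +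
  Num.sqrt ((1 - u) * (1 - 2 * u)))^-1.
have F0 : F 0 = (Num.sqrt 2)^-1.
  by rewrite /F !mulr0 !subr0 mulr1 sqrtr1 add0r invr1 mulr1.
rewrite -F0; apply: (@cvg_trans _ (F n%:R^-1 @[n --> \oo])).
  apply: near_eq_cvg; near=> m.
  have m1 : (1 < m)%N by near: m; exact: nbhs_infty_gt.
  by rewrite gapRatio_high ?lexx ?invf_lt1 ?ltr1n//= gapHigh_left.
apply: (continuous_cvg _ _ invr_nat_cvg0).
apply: cvgMr; apply: cvgV.
  by rewrite !mulr0 !subr0 mulr1 sqrtr1 add0r.
apply: cvgD; first by apply: cvgMr; exact: cvg_id.
apply: continuous_cvg; first exact: sqrt_continuous.
apply: cvgM; apply: cvgB; try exact: cvg_cst; first exact: cvg_id.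
by apply: cvgMr; exact: cvg_id.
Unshelve. all: by end_near.
Qed.

Section Intermediate.
Context (m q : nat -> nat) (al : nat -> R).
Local Notation n k := ((m k)%:R : R).
Local Notation Q k := ((q k)%:R : R).
Hypotheses (m0 : forall k, (0 < m k)%N) (al0 : forall k, 0 < al k)
  (mal : forall k, (n k)^-1 <= al k) (q0 : forall k, (0 < q k)%N)
  (qal : forall k, Q k * al k < 1 <= (Q k + 1) * al k)
  (mal_y : n k * al k @[k --> \oo] --> +oo)
  (al_0 : al k @[k --> \oo] --> (0 : R)).

Let n0 k : 0 < n k. Proof. by rewrite ltr0n. Qed.
Let Q0 k : 0 < Q k. Proof. by rewrite ltr0n. Qed.
Let Q1 k : 1 <= Q k. Proof. by rewrite ler1n. Qed.
Let Qa k : Q k * al k < 1. Proof. by case/andP: (qal k). Qed.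
Let aQ k : 1 <= (Q k + 1) * al k. Proof. by case/andP: (qal k). Qed.

(** The rank [q] is at least [1 / alpha - 1]. *)
Lemma rank_cvgy : Q k @[k --> \oo] --> +oo.
Proof.
have alV : (al k)^-1 @[k --> \oo] --> +oo by apply/cvgrVy => //; near=> k.
apply/cvgryPge => B; near=> k.
have : B + 1 <= (al k)^-1 by near: k; exact: cvgry_ge.
move=> /le_trans/(_ (_ : _ <= Q k + 1)); rewrite lerD2r; apply.
by rewrite -div1r ler_pdivrMr.
Unshelve. all: by end_near.
Qed.

(** From [q * alpha < 1] one gets [q / m < 1 / (m * alpha)]. *)
Lemma rank_over_size_cvg0 : Q k / n k @[k --> \oo] --> (0 : R).
Proof.
have malV : (n k * al k)^-1 @[k --> \oo] --> (0 : R).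
  by apply/gtr0_cvgV0 => //; near=> k; rewrite mulr_gt0.
apply: squeeze_cvgr (cvg_cst 0) malV; near=> k.
rewrite (divr_ge0 (ltW (Q0 k)) (ltW (n0 k)))/= invfM [X in X <= _]mulrC ler_pM2l ?invr_gt0//.
by rewrite -div1r ler_pdivlMr// ltW.
Unshelve. all: by end_near.
Qed.

Lemma inv_size_cvg0 : (n k)^-1 @[k --> \oo] --> (0 : R).
Proof.
by apply: squeeze_cvgr (cvg_cst 0) al_0; near=> k; rewrite mal invr_ge0 ltW.
Unshelve. all: by end_near.
Qed.

(** Here [th] lies in [[0, 1]], so [(q + th) / (q + 1)] tends to 1.  The other
    factor is the inverse of
    [sqrt q / m + sqrt ((1 - 1 / m) * (q * alpha - q / m))], in which
    [1 - alpha <= q * alpha < 1]. *)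
Lemma gap_intermediate_cvg :
  n k / (Q k * (Q k + 1)) *
    ((Q k + Num.sqrt (Q k * ((Q k + 1) * al k - 1))) /
     (1 + Num.sqrt ((n k - 1) * (n k * al k - 1)))) / (Num.sqrt (Q k))^-1
  @[k --> \oo] --> (1 : R).
Proof.
pose th k := Num.sqrt (Q k * ((Q k + 1) * al k - 1)).
pose s k := Num.sqrt ((n k - 1) * (n k * al k - 1)).
have split_cvg : (Q k + th k) / (Q k + 1) / (Num.sqrt (Q k) / n k +
    Num.sqrt ((1 - (n k)^-1) * (Q k * al k - Q k / n k))) @[k --> \oo] --> (1 : R).
  have one_sub : 1 - al k @[k --> \oo] --> (1 : R).
    by rewrite -{2}[1]subr0; apply: cvgB; [exact: cvg_cst|exact: al_0].
  have lhs : (Q k + th k) / (Q k + 1) @[k --> \oo] --> (1 : R).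
    apply: (squeeze_cvgr (h := fun=> 1) _ one_sub (cvg_cst _)); near=> k.
    have Qp : 0 < Q k + 1 by rewrite addr_gt0.
    have th0 : 0 <= th k by exact: sqrtr_ge0.
    have th1 : th k <= 1.
      rewrite -[X in _ <= X]sqrtr1 ler_wsqrtr//.
      have : (Q k + 1) * (Q k * al k) <= (Q k + 1) * 1 by rewrite ler_wpM2l// ltW.
      lra.
    rewrite ler_pdivlMr// ler_pdivrMr// mul1r lerD2l th1 andbT.
    have := aQ k; lra.
  have sqrt0 : Num.sqrt (Q k) / n k @[k --> \oo] --> (0 : R).
    apply: squeeze_cvgr (cvg_cst 0) rank_over_size_cvg0; near=> k.
    rewrite (divr_ge0 (sqrtr_ge0 _) (ltW (n0 k)))/= ler_pM2r ?invr_gt0//.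
    have {2}-> : Q k = Num.sqrt (Q k) * Num.sqrt (Q k).
      by rewrite -expr2 sqr_sqrtr// ltW.
    by rewrite ler_peMr ?sqrtr_ge0// -[X in X <= _]sqrtr1 ler_wsqrtr.
  have Qal1 : Q k * al k @[k --> \oo] --> (1 : R).
    apply: (squeeze_cvgr (h := fun=> 1) _ one_sub (cvg_cst _)); near=> k.
    rewrite (ltW (Qa k)) andbT; have := aQ k; lra.
  have sq1 : Num.sqrt ((1 - (n k)^-1) * (Q k * al k - Q k / n k))
      @[k --> \oo] --> (1 : R).
    have e1 : Num.sqrt ((1 - 0) * (1 - 0)) = 1 :> R by rewrite subr0 mulr1 sqrtr1.
    rewrite -[X in _ --> X]e1; apply: continuous_cvg; first exact: sqrt_continuous.
    apply: cvgM; apply: cvgB => //; first exact: cvg_cst.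
      exact: inv_size_cvg0.
    exact: rank_over_size_cvg0.
  have den : Num.sqrt (Q k) / n k +
      Num.sqrt ((1 - (n k)^-1) * (Q k * al k - Q k / n k)) @[k --> \oo] --> (0 + 1 : R).
    exact: cvgD.
  have e1 : 1 / (0 + 1) = 1 :> R by rewrite add0r divr1.
  rewrite -[X in _ --> X]e1; apply: cvgM => //; apply: cvgV => //.
apply: cvg_trans split_cvg; apply: near_eq_cvg; near=> k.
have r0 : 0 < Num.sqrt (Q k) by rewrite sqrtr_gt0.
have QE : Q k = Num.sqrt (Q k) ^+ 2 by rewrite sqr_sqrtr// ltW.
have -> : Num.sqrt ((1 - (n k)^-1) * (Q k * al k - Q k / n k)) =
    Num.sqrt (Q k) / n k * s k.
  have -> : (1 - (n k)^-1) * (Q k * al k - Q k / n k) =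
    (Num.sqrt (Q k) / n k) ^+ 2 * ((n k - 1) * (n k * al k - 1)).
    by rewrite exprMn -QE; field; rewrite gt_eqF.
  by rewrite sqrtrM ?sqr_ge0// sqrtr_sqr ger0_norm// divr_ge0 ?ltW.
rewrite -/(th k) -/(s k).
have s1 : 1 + s k != 0 by rewrite gt_eqF// one_sqrt_gt0.
have Qp : Q k + 1 != 0 by rewrite gt_eqF// addr_gt0.
have alg (N r t u : R) : N != 0 -> r != 0 -> 1 + u != 0 -> r ^+ 2 + 1 != 0 ->
    (r ^+ 2 + t) / (r ^+ 2 + 1) / (r / N + r / N * u) =
    N / (r ^+ 2 * (r ^+ 2 + 1)) * ((r ^+ 2 + t) / (1 + u)) / r^-1.
  move=> N0 rn u1 r2; rewrite -{1}[r / N]mulr1 -mulrDr.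
  by field; rewrite N0 rn u1 r2.
have := alg (n k) (Num.sqrt (Q k)) (th k) (s k).
by rewrite -QE; apply=> //; rewrite gt_eqF.
Unshelve. all: by end_near.
Qed.

End Intermediate.
End Asymptotics.

(** * Matrix sequences and the theorem *)

Section Sequences.
Context (R : realType).

Lemma traceRatio_itv (m : nat) (A : 'M[R]_m) : (1 < m)%N -> symposdefmx A ->
  m%:R^-1 <= traceRatio A < 1.
Proof. by move=> m1 /(laguerre_ratio m1)[]. Qed.

Lemma laguerre_ratio_intermediate (m : nat -> nat) (A : forall k, 'M[R]_(m k)) :
  (forall k, (1 < m k)%N) -> (forall k, symposdefmx (A k)) ->
  (m k)%:R * traceRatio (A k) @[k --> \oo] --> +oo ->
  traceRatio (A k) @[k --> \oo] --> (0 : R) ->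
  [/\ ((qOf (traceRatio (A k)))%:~R : R) @[k --> \oo] --> +oo,
      ((qOf (traceRatio (A k)))%:~R / (m k)%:R : R) @[k --> \oo] --> (0 : R)
    & (laguerreBound (A k) / maxSmallestEig (A k)) /
      (Num.sqrt (qOf (traceRatio (A k)))%:~R)^-1 @[k --> \oo] --> (1 : R)].
Proof.
move=> m1 Apd may a0; pose al k := traceRatio (A k).
have m0 k : (0 < m k)%N by exact: ltnW.
have mal k : (m k)%:R^-1 <= al k by case/andP: (traceRatio_itv (m1 k) (Apd k)).
have al0 k : 0 < al k by apply: lt_le_trans (mal k); rewrite invr_gt0 ltr0n.
have /choice[q qP] : forall k, exists q : nat, [/\ (0 < q)%N,
    q%:R * al k < 1 <= (q%:R + 1) * al k & qOf (al k) = q%:Z].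
  move=> k; apply: qOf_natP; rewrite al0.
  by case/andP: (traceRatio_itv (m1 k) (Apd k)).
have q0 k : (0 < q k)%N by case: (qP k).
have qal k : (q k)%:R * al k < 1 <= ((q k)%:R + 1) * al k by case: (qP k).
have qE k : (qOf (traceRatio (A k)))%:~R = (q k)%:R :> R.
  by case: (qP k) => _ _ ->; rewrite -pmulrn.
have gE k : laguerreBound (A k) / maxSmallestEig (A k) =
    (m k)%:R / ((q k)%:R * ((q k)%:R + 1)) *
    (((q k)%:R + Num.sqrt ((q k)%:R * (((q k)%:R + 1) * al k - 1))) /
     (1 + Num.sqrt (((m k)%:R - 1) * ((m k)%:R * al k - 1)))).
  by rewrite (ratio_max_smallestEig (m1 k) (Apd k)) /gapRatio qE.
split.
- by under eq_fun do rewrite qE; exact: (rank_cvgy al0 qal a0).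
- under eq_fun do rewrite qE.
  exact: (rank_over_size_cvg0 m0 al0 q0 qal may).
- under eq_fun do rewrite qE gE.
  exact: (gap_intermediate_cvg m0 al0 mal q0 qal may a0).
Qed.

(** For one inverse eigenvalue [N^2] and [N^3] inverse eigenvalues 1, with
    [N >= 2], the sums are [N^2 * (N + 1)] and [N^3 * (N + 1)], so
    [alpha = 1 / (N * (N + 1))]: it tends to 0 while [m * alpha] tends to
    infinity, and the ratio is asymptotic to [1 / sqrt q]. *)
Lemma laguerre_ratio_loose (eps : R) : 0 < eps ->
  exists (m : nat) (A : 'M[R]_m),
    [/\ (1 < m)%N, symposdefmx A,
        (m%:R - 1)^-1 <= traceRatio A < 2^-1
      & laguerreBound A / maxSmallestEig A < eps].
Proof.
move=> eps0; pose n k := k.+2; pose m k := (n k ^ 3).+1.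
pose N k : R := (n k)%:R.
have N2 k : 2 <= N k by rewrite ler_nat.
have N0 k : 0 < N k by rewrite ltr0n.
have mE k : (m k)%:R = N k ^+ 3 + 1 :> R by rewrite /m -natr1 natrX.
pose mu k (i : 'I_(m k)) : R := if i == ord0 then N k ^+ 2 else 1.
have mu0 k i : 0 < @mu k i by rewrite /mu; case: ifP => // _; rewrite exprn_gt0.
have musum k (F : R -> R) : \sum_i F (@mu k i) = F (N k ^+ 2) + N k ^+ 3 * F 1.
  rewrite big_ord_recl {1}/mu eqxx; congr (_ + _).
  rewrite (eq_bigr (fun=> F 1)) => [|i _]; last by rewrite /mu.
  by rewrite sumr_const card_ord -mulr_natl natrX.
pose A k : 'M[R]_(m k) := diag_mx (\row_i (@mu k i)^-1).
have Apd k : symposdefmx (A k) by exact: diag_symposdef.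
have alE k : traceRatio (A k) = (N k * (N k + 1))^-1.
  rewrite /traceRatio diag_invTrace// diag_invSqTrace//.
  rewrite (musum _ (fun x => x ^+ 2)) (musum _ id) expr1n !mulr1.
  have Nk := N0 k; have N1 : N k + 1 != 0 by rewrite gt_eqF// addr_gt0.
  have -> : N k ^+ 2 + N k ^+ 3 = N k ^+ 2 * (N k + 1) by ring.
  by field; rewrite N1 gt_eqF.
have m1 k : (1 < m k)%N by rewrite ltnS expn_gt0.
have N_y : N k @[k --> \oo] --> +oo.
  apply/cvgryPge => B; near=> k; apply: (@le_trans _ _ k%:R).
    by near: k; apply: cvgry_ge; exact: cvgr_idn.
  by rewrite ler_nat /n; lia.
have NV0 : (N k)^-1 @[k --> \oo] --> (0 : R).
  by apply/gtr0_cvgV0 => //; exact: nearW.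
have al0 : traceRatio (A k) @[k --> \oo] --> (0 : R).
  apply: (squeeze_cvgr (f := fun=> 0) _ (cvg_cst _) NV0); near=> k.
  have Nk := N0 k; have P0 : 0 < N k * (N k + 1) by rewrite mulr_gt0// addr_gt0.
  rewrite alE invr_ge0 (ltW P0)/= lef_pV2 ?posrE//.
  by rewrite ler_peMr ?lerDr ?(ltW Nk).
have mal_y : (m k)%:R * traceRatio (A k) @[k --> \oo] --> +oo.
  apply/cvgryPge => B; near=> k.
  have NB : B + 1 <= N k by near: k; exact: cvgry_ge.
  have Np := N0 k; have P0 : 0 < N k * (N k + 1) by rewrite mulr_gt0// addr_gt0.
  rewrite mE alE ler_pdivlMr//.
  apply: (@le_trans _ _ ((N k - 1) * (N k * (N k + 1)))).
    by rewrite ler_pM2r// lerBrDr.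
  have -> : (N k - 1) * (N k * (N k + 1)) = N k ^+ 3 - N k by ring.
  lra.
have [q_y _ ratio1] := laguerre_ratio_intermediate m1 Apd mal_y al0.
near \oo => k.
exists (m k), (A k); split => //.
  have Np := N0 k; have P0 : 0 < N k * (N k + 1) by rewrite mulr_gt0// addr_gt0.
  have N22 := N2 k.
  rewrite alE mE addrK lef_pV2 ?posrE ?exprn_gt0//.
  rewrite ltf_pV2 ?posrE//; apply/andP; split; last by nra.
  rewrite exprS ler_pM2l//; nra.
have ratio2 : laguerreBound (A k) / maxSmallestEig (A k) /
    (Num.sqrt (qOf (traceRatio (A k)))%:~R)^-1 < 2.
  by near: k; apply: (cvgr_lt (1 : R)) => //; rewrite ltr1n.
(* The normalized ratio is eventually below 2 and [sqrt q] above [2 / eps]. *)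
have qbig : (2 / eps) ^+ 2 <= (qOf (traceRatio (A k)))%:~R.
  by near: k; exact: cvgry_ge.
have e2 : 0 < 2 / eps by rewrite divr_gt0.
have sbig : 2 / eps <= Num.sqrt (qOf (traceRatio (A k)))%:~R.
  by rewrite -[2 / eps]gtr0_norm// -sqrtr_sqr ler_wsqrtr.
have s0 := lt_le_trans e2 sbig.
move: ratio2; rewrite invrK -ltr_pdivlMr// => /lt_le_trans; apply.
by rewrite ler_pdivrMr// mulrC -ler_pdivrMr.
Unshelve. all: by end_near.
Qed.

End Sequences.

Theorem mainTheorem3 (R : realType) :
  (* the ratio formula, and its meaning for actual matrices *)
  (forall (m : nat) (A : 'M[R]_m), (1 < m)%N -> symposdefmx A ->
     let alpha := traceRatio A in
     let q := qOf alpha in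
     [/\ m%:R^-1 <= alpha < 1,
         forall p : int, bracket alpha p <-> p = q,
         (* the supremum defining lambda_m^* is a (finite) maximum *)
         smallestEntries m (invTrace A) (invSqTrace A) (maxSmallestEig A)%:E /\
         ubound (smallestEntries m (invTrace A) (invSqTrace A))
           (maxSmallestEig A)%:E,
         laguerreBound A / maxSmallestEig A = gapRatio m alpha
       & [/\ gapRatio m alpha <= laguerreBound A / smallestEig A,
             q <> m%:Z - 1 ->
               gapRatio m alpha < laguerreBound A / smallestEig A /\
               forall eps : R, 0 < eps -> exists B : 'M[R]_m,
                 [/\ symposdefmx B, invTrace B = invTrace A,
                     invSqTrace B = invSqTrace A
                   & laguerreBound B / smallestEig B < gapRatio m alpha + eps]
           & q = m%:Z - 1 ->
               exists B : 'M[R]_m,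
                 [/\ symposdefmx B, invTrace B = invTrace A,
                     invSqTrace B = invSqTrace A
                   & laguerreBound B / smallestEig B = gapRatio m alpha]]]) /\
  (* (i) *)
  (forall m : nat, (1 < m)%N ->
     [/\ forall A : 'M[R]_m, symposdefmx A ->
           m%:R^-1 <= traceRatio A < (m%:R - 1)^-1 ->
           [/\ qOf (traceRatio A) = m%:Z - 1,
               laguerreBound A / maxSmallestEig A =
                 (m%:R - 1)^-1 *
                 (1 + (m%:R - 2) /
                      (1 + Num.sqrt ((m%:R - 1) * (m%:R * traceRatio A - 1))))
             & 2^-1 < laguerreBound A / maxSmallestEig A],
         (* constant for m = 2, strictly decreasing for m > 2 *)
         forall x y : R, m%:R^-1 <= x -> x < y -> y < (m%:R - 1)^-1 ->
           gapRatio m y <= gapRatio m x /\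
           ((2 < m)%N -> gapRatio m y < gapRatio m x),
         gapRatio m (m%:R^-1 : R) = 1,
         forall x : R, m%:R^-1 <= x < (m%:R - 1)^-1 -> gapRatio m x <= 1
       & gapRatio m x @[x --> ((m%:R - 1)^-1 : R)^'-] -->
           (2^-1 * (m%:R / (m%:R - 1)) : R)]) /\
  (* (ii) *)
  (forall (m : nat -> nat) (A : forall k, 'M[R]_(m k)),
     (forall k, (1 < m k)%N) -> (forall k, symposdefmx (A k)) ->
     (m k)%:R * traceRatio (A k) @[k --> \oo] --> +oo ->
     traceRatio (A k) @[k --> \oo] --> (0 : R) ->
     [/\ ((qOf (traceRatio (A k)))%:~R : R) @[k --> \oo] --> +oo,
         ((qOf (traceRatio (A k)))%:~R / (m k)%:R : R) @[k --> \oo] --> (0 : R)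
       & (laguerreBound (A k) / maxSmallestEig (A k)) /
         (Num.sqrt (qOf (traceRatio (A k)))%:~R)^-1 @[k --> \oo] --> (1 : R)]) /\
  (* (iii) *)
  ((forall m : nat, (1 < m)%N ->
      [/\ forall A : 'M[R]_m, symposdefmx A -> 2^-1 <= traceRatio A < 1 ->
            qOf (traceRatio A) = 1 /\
            laguerreBound A / maxSmallestEig A =
              m%:R / 2 *
              ((1 + Num.sqrt (2 * traceRatio A - 1)) /
               (1 + Num.sqrt ((m%:R - 1) * (m%:R * traceRatio A - 1)))),
          (* constant for m = 2, strictly increasing for m > 2 *)
          forall x y : R, 2^-1 <= x -> x < y -> y < 1 ->
            gapRatio m x <= gapRatio m y /\
            ((2 < m)%N -> gapRatio m x < gapRatio m y),
          gapRatio m (2^-1 : R) =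
            (Num.sqrt 2)^-1 *
            (Num.sqrt 2 / m%:R +
             Num.sqrt ((1 - m%:R^-1) * (1 - 2 / m%:R)))^-1,
          forall x : R, 2^-1 <= x < 1 -> gapRatio m (2^-1 : R) <= gapRatio m x
        & gapRatio m x @[x --> (1 : R)^'-] --> (1 : R)]) /\
   gapRatio m (2^-1 : R) @[m --> \oo] --> ((Num.sqrt 2)^-1 : R) /\
   (forall eps : R, 0 < eps ->
      \forall m \near \oo, forall A : 'M[R]_m, symposdefmx A ->
        2^-1 <= traceRatio A < 1 ->
        (Num.sqrt 2)^-1 - eps < laguerreBound A / maxSmallestEig A)) /\
  (* tight near 1/m; arbitrarily loose for intermediate alpha *)
  ((forall m : nat, (1 < m)%N ->
      gapRatio m x @[x --> (m%:R^-1 : R)^'+] --> (1 : R)) /\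
   (forall eps : R, 0 < eps ->
      exists (m : nat) (A : 'M[R]_m),
        [/\ (1 < m)%N, symposdefmx A,
            (m%:R - 1)^-1 <= traceRatio A < 2^-1
          & laguerreBound A / maxSmallestEig A < eps])).
Proof.
split; first exact: laguerre_ratio.
have ratioE m (A : 'M[R]_m) : (1 < m)%N -> symposdefmx A ->
    laguerreBound A / maxSmallestEig A = gapRatio m (traceRatio A).
  exact: ratio_max_smallestEig.
split.
  move=> m m1; split.
  - move=> A Apd al; rewrite ratioE// gapRatio_low//; split => //.
      exact: qOf_low.
    exact: gapLow_gt_half.
  - move=> x y nx xy yn.
    have xI : m%:R^-1 <= x < (m%:R - 1)^-1 by rewrite nx (lt_trans xy).
    have yI : m%:R^-1 <= y < (m%:R - 1)^-1 by rewrite yn (le_trans nx)// ltW.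
    by rewrite !gapRatio_low//; exact: gapLow_decr.
  - by rewrite gapRatio_low ?gapLow_left// lexx inv_pred_gt.
  - by move=> x xI; rewrite gapRatio_low// gapLow_le1//; case/andP: xI.
  - exact: gapRatio_cvg_low_left.
split; first exact: laguerre_ratio_intermediate.
have half_itv : 2^-1 <= (2^-1 : R) < 1 by rewrite lexx invf_lt1 ?ltr1n.
split; last first.
  split; last exact: laguerre_ratio_loose.
  by move=> m m1; exact: gapRatio_cvg_low_right.
split.
  move=> m m1; split.
  - move=> A Apd al; rewrite ratioE// gapRatio_high//; split => //.
    exact: qOf_high.
  - move=> x y hx xy y1.
    have xI : 2^-1 <= x < 1 by rewrite hx (lt_trans xy).
    have yI : 2^-1 <= y < 1 by rewrite y1 (le_trans hx)// ltW.
    by rewrite !gapRatio_high//; exact: gapHigh_incr.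
  - by rewrite gapRatio_high// gapHigh_left.
  - by move=> x xI; rewrite !gapRatio_high// gapHigh_ge.
  - exact: gapRatio_cvg_high.
split; first exact: gapRatio_half_cvg.
move=> eps eps0; near=> m => A Apd al.
have m1 : (1 < m)%N by near: m; exact: nbhs_infty_gt.
rewrite ratioE// gapRatio_high//; apply: lt_le_trans (gapHigh_ge m1 al).
rewrite -gapRatio_high//; near: m.
by apply: (cvgr_gt ((Num.sqrt 2)^-1 : R)); [exact: gapRatio_half_cvg|rewrite gtrBl].
Unshelve. all: by end_near.
Qed.
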